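(* Let $\mathcal N=\{1,\dots,N\}$ and consider $N$ local measurements $z_i(t)=\phi_i^\top(t)\theta+\varepsilon_i(t)$, $t\ge0$, $i\in\mathcal N$, where each $\phi_i:[0,\infty)\to\mathbb{R}^n$ is smooth and uniformly bounded, $\theta\in\mathbb{R}^n$ is a constant unknown parameter, each $z_i$ is continuous, and each measurement noise $\varepsilon_i$ is bounded. Suppose that for each $i\in\mathcal N$ the regressor $\phi_i$ displays partial persistent excitation (PPE) with lack of persistency of order $q_i$, with associated orthogonal projection matrix $\varPhi_i$; that the complementary PPE condition $\sum_{i=1}^N\varPhi_i>0$ (positive definite) holds; and that the directed communication graph $\mathcal G$ with weighted adjacency matrix $[a_{ij}]$ and Laplacian $\mathcal L$ is strongly connected. Let $\alpha_i,\beta_i,\gamma_i,\delta_i,\kappa_i,\eta_{id},\eta_{iu}>0$ and $\hat\theta_{i0}\in\mathbb{R}^n$ ($i\in\mathcal N$) be arbitrary, let $\hat\theta_i(t)$ be the estimates generated by the distributed parameter learning algorithm described in the context, let $\tilde\theta_i=\hat\theta_i-\theta$ and $\tilde\theta_I=\mathrm{col}(\tilde\theta_1,\dots,\tilde\theta_N)$, and let $\tilde\theta_I^*(t)$ be the trajectory of the reference system described in the context. Then there exist two positive reals $\rho_a,\rho_b$ such that $$\left\|\tilde\theta_I(t)-\tilde\theta_I^*(t)\right\|\le\rho_a\mathrm{e}^{-\rho_b t}\qquad\text{for all }t\ge0,$$ and $\rho_b$ can be made arbitrarily large by increasing the $\gamma_i$ and $\eta_{iu}$. In particular, in the noise-free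 case $\varepsilon_i(t)\equiv0$ for all $i\in\mathcal N$, for any $\rho_d<\min_{i\in\mathcal N}\{\beta_i/2\}$ there exists a positive real $\rho_c$ such that $$\left\|\tilde\theta_I(t)\right\|\le\rho_c\,\mathrm{e}^{-\rho_d t}\qquad\text{for all }t\ge0.$$
   Context: Notation: $\|\cdot\|$ is the Euclidean norm of vectors and the induced 2-norm of matrices; inequalities between symmetric matrices are in the positive (semi)definite order; $\mathrm{diag}(\cdot)$ is block-diagonal arrangement, $\mathrm{col}(\cdot)$ is vertical stacking, $\otimes$ is the Kronecker product. PPE: $\phi_i$ displays partial persistent excitation with lack of persistency of order $q_i$ ($0\le q_i\le n$), with associated $\varPhi_i$, if $\varPhi_i\in\mathbb{R}^{n\times n}$ is a real orthogonal projection matrix ($\varPhi_i^2=\varPhi_i=\varPhi_i^\top$) of rank $n-q_i$ and, for some positive reals $T,k_{ia},k_{ib}$ ($T$ common to all $i$), $$k_{ia}\varPhi_i\le\int_t^{t+T}\phi_i(\tau)\phi_i^\top(\tau)\,\mathrm{d}\tau\le k_{ib}\varPhi_i\qquad\forall t\ge0.$$ The columns of $N_{id}\in\mathbb{R}^{n\times(n-q_i)}$ form an orthonormal basis of $\mathrm{Im}\,\varPhi_i$ (local PE subspace), and those of $N_{iu}\in\mathbb{R}^{n\times q_i}$ an orthonormal basis of $\mathrm{Ker}\,\varPhi_i$ (local non-PE subspace). Graph: $\mathcal G=(\mathcal N,\mathcal E)$ is directed; $a_{ij}>0$ if $(j,i)\in\mathcal E$ (edge from $j$ to $i$), $a_{ij}=0$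 otherwise, and $a_{ii}=0$. The Laplacian $\mathcal L=[l_{ij}]$ has $l_{ii}=\sum_{k=1}^N a_{ik}$ and $l_{ij}=-a_{ij}$ for $i\ne j$. Strongly connected means there is a directed path from every node to every other node. Distributed parameter learning algorithm. Each node $i$ runs (time arguments omitted where clear), with $Q_i(0)=P_i(0)=0_{n\times n}$, $$\dot Q_i=-\beta_iQ_i+\phi_i\phi_i^\top,$$ $$\dot P_i(t)=-\gamma_iP_i(t)+\gamma_iI-\gamma_i^2\int_0^t\mathrm{e}^{-\gamma_i(t-\tau)}\bar N_{iu}(\tau)\bar N_{iu}^\top(\tau)\,\mathrm{d}\tau,$$ $$\bar N_{iu}(\tau)=\hat N_{iu}(k\delta_i)\ \text{ for }k\delta_i\le\tau<(k+1)\delta_i,\ k=0,1,2,\dots,$$ where the columns of $\hat N_{iu}(k\delta_i)$ form an orthonormal basis of $\mathrm{Ker}\,Q_i(k\delta_i)$ (so $\hat N_{iu}\hat N_{iu}^\top$ is the orthogonal projection onto that kernel, equal to $0$ if the kernel is trivial); and $$\dot\varphi_i=-\beta_i\varphi_i+z_i\phi_i,\quad\varphi_i(0)=\alpha_i\hat\theta_{i0},$$ $$\dot\varOmega_i=\beta_i\varOmega_i-\varOmega_iR_i\varOmega_i,\quad\varOmega_i(0)=\kappa_i^{-1}I,$$ $$R_i=P_i\phi_i\phi_i^\top P_i+\kappa_i\beta_i(I-P_i)+\dot P_iQ_iP_i+P_iQ_i\dot P_i+\left(\alpha_i\mathrm{e}^{-\beta_it}-\kappa_i\right)\dot P_i,$$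 $$\dot{\hat\theta}_{id}=-\varOmega_i\left(R_i\hat\theta_{id}-z_iP_i\phi_i-\dot P_i\varphi_i\right),\quad\hat\theta_{id}(0)=0,$$ $$\dot{\hat\theta}_{iu}=-\eta_{id}P_i\hat\theta_{iu}-\eta_{iu}(I-P_i)\sum_{j=1}^Na_{ij}(\hat\theta_i-\hat\theta_j),\quad\hat\theta_{iu}(0)=\hat\theta_{i0},$$ $$\hat\theta_i=P_i\hat\theta_{id}+(I-P_i)\hat\theta_{iu}.$$ Local least squares solutions: for $t\ge0$, $\theta_i^*(t)$ is the minimizer over $v\in\mathbb{R}^n$ of $$\frac12\int_0^t\mathrm{e}^{-\beta_i(t-\tau)}\left(z_i(\tau)-v^\top\phi_i(\tau)\right)^2\mathrm{d}\tau+\frac{\alpha_i}{2}\mathrm{e}^{-\beta_it}\left\|v-\hat\theta_{i0}\right\|^2.$$ Reference system: let $N_D=\mathrm{diag}(N_{1d},\dots,N_{Nd})$, $N_U=\mathrm{diag}(N_{1u},\dots,N_{Nu})$, $H_U=\mathrm{diag}(\eta_{1u}I_{q_1},\dots,\eta_{Nu}I_{q_N})$, and $$\tilde\theta_D^*(t)=N_D^\top\,\mathrm{col}\left(\theta_1^*(t)-\theta,\dots,\theta_N^*(t)-\theta\right),$$ $$\dot{\tilde\theta}_U^*(t)=-H_UN_U^\top(\mathcal L\otimes I_n)\left(N_U\tilde\theta_U^*(t)+N_D\tilde\theta_D^*(t)\right),\quad\tilde\theta_U^*(0)=0,$$ $$\tilde\theta_I^*(t)=N_D\tilde\theta_D^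*(t)+N_U\tilde\theta_U^*(t).$$
   Formalization: The noise-free bound for every ρ_d < min β_i/2 is claimed only for all sufficiently large γ_i and η_iu; for arbitrary gains it is claimed only for ρ_d ≤ ρ_b, since for arbitrary gains it fails (N = n = 1, φ = 1, θ ≠ 0, γ < β/2). *)

(* Defs.v *)
(* Functions on the half-line [0, +oo) are total functions on R; every
   hypothesis and conclusion below only concerns their values at t >= 0. *)
From HB Require Import structures.
From mathcomp Require Export all_boot all_order all_algebra.
From mathcomp Require Export all_classical all_reals all_analysis.

Set Implicit Arguments.
Unset Strict Implicit.
Unset Printing Implicit Defensive.

Import Order.TTheory GRing.Theory Num.Theory.
Import numFieldNormedType.Exports.
Local Open Scope classical_set_scope.
Local Open Scope ring_scope.

Section linear_algebra.
Variable R : realType.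

(* The library norm on 'cV[R]_n is the max norm. *)
Definition enorm n (v : 'cV[R]_n) : R := Num.sqrt (\sum_(i < n) v i 0 ^+ 2).

Definition dotv n (u v : 'cV[R]_n) : R := (u^T *m v) 0 0.

Definition psd n (A : 'M[R]_n) : Prop :=
  A^T = A /\ forall v : 'cV[R]_n, 0 <= dotv v (A *m v).

Definition posdef n (A : 'M[R]_n) : Prop :=
  A^T = A /\ forall v : 'cV[R]_n, v != 0 -> 0 < dotv v (A *m v).

Definition loewner_le n (A B : 'M[R]_n) : Prop := psd (B - A).

Definition orthogonal_projection n (A : 'M[R]_n) : Prop :=
  A *m A = A /\ A^T = A.

(* The library reads subspaces as row spaces, whence the transposes: the image
   of A is the row space of A^T, its kernel the row space of kermx A^T. *)
Definition orthonormal_basis_im n k (A : 'M[R]_n) (B : 'M[R]_(n, k)) : Prop :=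
  B^T *m B = 1%:M /\ (B^T == A^T)%MS.

Definition orthonormal_basis_ker n k (A : 'M[R]_n) (B : 'M[R]_(n, k)) : Prop :=
  B^T *m B = 1%:M /\ (B^T == kermx A^T)%MS.

(* \mxdiag only covers square blocks. *)
Definition blkdiag N (p_ q_ : 'I_N -> nat) (B : forall i, 'M[R]_(p_ i, q_ i)) :
    'M[R]_(\sum_i p_ i, \sum_i q_ i) :=
  \mxblock_(i < N, j < N) (if i == j then conform_mx 0 (B i) else 0).

(* The Kronecker product of A and the identity matrix of size n, with the
   index type of N stacked vectors of size n. *)
Definition kron_id N n (A : 'M[R]_N) :
    'M[R]_(\sum_(i < N) n, \sum_(j < N) n) :=
  \mxblock_(i < N, j < N) ((A i j)%:M : 'M[R]_n).

Definition mxintegral m n (D : set R) (A : R -> 'M[R]_(m, n)) : 'M[R]_(m, n) :=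
  \matrix_(i < m, j < n) \int[lebesgue_measure]_(x in D) A x i j.

End linear_algebra.

Section differential_equations.
Variable R : realType.

(* x' = F on [0, +oo): when F is right-continuous at 0, which is the case in
   all uses below, the right derivative of x at 0 is then F 0. *)
Definition ode (V : normedModType R) (x F : R -> V) : Prop :=
  {within `[0, +oo[, continuous x} /\
  forall t : R, 0 < t -> is_derive t (1 : R) x (F t).

Definition ivp (V : normedModType R) (x : R -> V) (x0 : V) (F : R -> V) : Prop :=
  x 0 = x0 /\ ode x F.

(* C^oo on [0, +oo): f_ k is the k-th derivative, one-sided at 0. *)
Definition smooth (V : normedModType R) (f : R -> V) : Prop :=
  exists f_ : nat -> R -> V,
    (forall t, 0 <= t -> f_ 0%N t = f t) /\
    (forall k, ode (f_ k) (f_ k.+1)).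

End differential_equations.

Section excitation_and_graph.
Variable R : realType.

(* Partial persistent excitation over windows of length T, with lack of
   persistency of order q and associated projection Phi. *)
Definition ppe n (T : R) (phi : R -> 'cV[R]_n) (q : nat) (Phi : 'M[R]_n) : Prop :=
  [/\ (q <= n)%N, orthogonal_projection Phi, \rank Phi = (n - q)%N &
    exists ka kb : R, [/\ 0 < ka, 0 < kb & forall t, 0 <= t ->
      let G := mxintegral `[t, t + T] (fun tau => phi tau *m (phi tau)^T) in
      loewner_le (ka *: Phi) G /\ loewner_le G (kb *: Phi)]].

(* E j i is the edge from j to i. *)
Definition weighted_adjacency N (E : rel 'I_N) (a : 'M[R]_N) : Prop :=
  [/\ forall i j, E j i -> 0 < a i j,
      forall i j, ~~ E j i -> a i j = 0 &
      forall i, a i i = 0].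

Definition strongly_connected N (E : rel 'I_N) : Prop :=
  forall i j, connect E i j.

Definition laplacian N (a : 'M[R]_N) : 'M[R]_N :=
  \matrix_(i, j) (if i == j then \sum_k a i k else - a i j).

End excitation_and_graph.

Section algorithm.
Variable R : realType.

Record node_state n := NodeState {
  nQ : R -> 'M[R]_n;
  nP : R -> 'M[R]_n;
  nOmega : R -> 'M[R]_n;
  nvarphi : R -> 'cV[R]_n;
  nthd : R -> 'cV[R]_n;
  nthu : R -> 'cV[R]_n;
  nkdim : nat -> nat;                           (* dimension of Ker Q(k delta) *)
  nNhat : forall k : nat, 'M[R]_(n, nkdim k)    (* orthonormal basis of it *)
}.

Definition estimate n (s : node_state n) (t : R) : 'cV[R]_n :=
  nP s t *m nthd s t + (1%:M - nP s t) *m nthu s t.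

(* For tau >= 0, Num.truncn (tau / delta) is the k such that
   k delta <= tau < (k + 1) delta. *)
Definition Nbar n (delta : R) (s : node_state n) (tau : R) :
    'M[R]_(n, nkdim s (Num.truncn (tau / delta))) :=
  nNhat s (Num.truncn (tau / delta)).

Definition Pdot n (gamma delta : R) (s : node_state n) (t : R) : 'M[R]_n :=
  - (gamma *: nP s t) + gamma *: 1%:M
  - gamma ^+ 2 *: mxintegral `[0, t] (fun tau =>
      expR (- (gamma * (t - tau))) *:
        (Nbar delta s tau *m (Nbar delta s tau)^T)).

Definition Rmx n (alpha beta gamma delta kappa : R) (phi : R -> 'cV[R]_n)
    (s : node_state n) (t : R) : 'M[R]_n :=
  let Q := nQ s t in let P := nP s t in let P' := Pdot gamma delta s t in
  P *m phi t *m (phi t)^T *m P + (kappa * beta) *: (1%:M - P)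
  + P' *m Q *m P + P *m Q *m P'
  + (alpha * expR (- (beta * t)) - kappa) *: P'.

Definition learning_algorithm N n
    (alpha beta gamma delta kappa eta_d eta_u : 'I_N -> R) (a : 'M[R]_N)
    (theta0 : 'I_N -> 'cV[R]_n) (phi : 'I_N -> R -> 'cV[R]_n)
    (z : 'I_N -> R -> R) (s : 'I_N -> node_state n) : Prop :=
  forall i : 'I_N,
  let Q := nQ (s i) in let P := nP (s i) in let Omega := nOmega (s i) in
  let varphi := nvarphi (s i) in let thd := nthd (s i) in
  let thu := nthu (s i) in
  let P' := Pdot (gamma i) (delta i) (s i) in
  let Ri := Rmx (alpha i) (beta i) (gamma i) (delta i) (kappa i) (phi i) (s i) in
  [/\ ivp Q 0 (fun t => - (beta i *: Q t) + phi i t *m (phi i t)^T),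
      ivp P 0 P' /\
      (forall k : nat,
        orthonormal_basis_ker (Q (k%:R * delta i)) (nNhat (s i) k)),
      ivp varphi (alpha i *: theta0 i)
        (fun t => - (beta i *: varphi t) + z i t *: phi i t),
      ivp Omega ((kappa i)^-1 *: 1%:M)
        (fun t => beta i *: Omega t - Omega t *m Ri t *m Omega t) &
      ivp thd 0
        (fun t => - (Omega t *m
           (Ri t *m thd t - z i t *: (P t *m phi i t) - P' t *m varphi t))) /\
      ivp thu (theta0 i)
        (fun t => - (eta_d i *: (P t *m thu t))
           - eta_u i *: ((1%:M - P t) *m
               \sum_(j < N) a i j *: (estimate (s i) t - estimate (s j) t)))].

Definition ls_cost n (alpha beta : R) (theta0 : 'cV[R]_n) (phi : R -> 'cV[R]_n)
    (z : R -> R) (t : R) (v : 'cV[R]_n) : R :=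
  1 / 2 * \int[lebesgue_measure]_(tau in `[0, t])
      (expR (- (beta * (t - tau))) * (z tau - dotv v (phi tau)) ^+ 2)
  + alpha / 2 * expR (- (beta * t)) * enorm (v - theta0) ^+ 2.

Definition ls_solution n (alpha beta : R) (theta0 : 'cV[R]_n)
    (phi : R -> 'cV[R]_n) (z : R -> R) (thstar : R -> 'cV[R]_n) : Prop :=
  forall t, 0 <= t -> forall v,
    ls_cost alpha beta theta0 phi z t (thstar t)
      <= ls_cost alpha beta theta0 phi z t v.

End algorithm.

Section reference_system.
Variables (R : realType) (N n : nat) (q : 'I_N -> nat).
Variables (Nd : forall i, 'M[R]_(n, n - q i)) (Nu : forall i, 'M[R]_(n, q i)).
Variables (theta : 'cV[R]_n) (thstar : 'I_N -> R -> 'cV[R]_n).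

Let ND : 'M[R]_(\sum_(i < N) n, \sum_(i < N) (n - q i)) := blkdiag Nd.
Let NU : 'M[R]_(\sum_(i < N) n, \sum_(i < N) q i) := blkdiag Nu.

(* The stacked errors col(x_1 - theta, ..., x_N - theta). *)
Definition stacked_error (x : 'I_N -> 'cV[R]_n) : 'cV[R]_(\sum_(i < N) n) :=
  \mxcol_(i < N) (x i - theta).

Definition thetaD_star (t : R) : 'cV[R]_(\sum_(i < N) (n - q i)) :=
  ND^T *m stacked_error (fun i => thstar i t).

Definition reference_system (a : 'M[R]_N) (eta_u : 'I_N -> R)
    (thetaU : R -> 'cV[R]_(\sum_(i < N) q i)) : Prop :=
  let HU : 'M[R]_(\sum_(i < N) q i) := \mxdiag_(i < N) (eta_u i)%:M in
  ivp thetaU 0 (fun t => - (HU *m NU^T *m kron_id n (laplacian a) *m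
                            (NU *m thetaU t + ND *m thetaD_star t))).

Definition thetaI_star (thetaU : R -> 'cV[R]_(\sum_(i < N) q i)) (t : R) :
    'cV[R]_(\sum_(i < N) n) :=
  ND *m thetaD_star t + NU *m thetaU t.

End reference_system.

(* Main.v *)
(* Per node, regressors lie in Im Phi, so Ker Q(t) = Ker Phi for t >= T, and the
   filter drives P to Phi at any rate below gamma. The Riccati equation is
   solved in closed form: Omega is the inverse of
   S = P Q P + alpha e^(-beta t) P + kappa (I - P), and S thd = P varphi. The
   normal equations (Q + alpha e^(-beta t) I) th* = varphi then show that
   P thd - Phi th* inherits the decay of P - Phi, because the limit
   Q + alpha e^(-beta t) Phi + kappa (I - Phi) of S is uniformly coercive.
   Across the network, a positive left null vector xi of the Laplacian makes
   sum_i xi_i / eta_iu |y_i|^2 a Lyapunov function for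
   y_i' = - eta_iu (I - Phi_i) (L y)_i with y_i in Ker Phi_i: its dissipation
   sum_ij xi_i a_ij |y_i - y_j|^2 controls |y|^2 since the spaces Ker Phi_i
   intersect trivially. Both the deviation from the reference system and the
   reference system itself are perturbations of this contraction. *)
From mathcomp Require Import ring lra measurable_realfun.
Require Import Defs.

Set Implicit Arguments.
Unset Strict Implicit.
Unset Printing Implicit Defensive.

Import Order.TTheory GRing.Theory Num.Theory.
Import numFieldNormedType.Exports.
Local Open Scope classical_set_scope.
Local Open Scope ring_scope.

(** * Ordinary differential equations on the half-line *)

Section ode_calculus.
Variable R : realType.
Implicit Types (f g df dg : R -> R).

(** Rates are handled without tracking constants: [expO D rho X] says entrywise that [X] is of order
    [expR (- (rho * t))] on [D]; products add rates, and rate 0 is boundedness. Identities between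
    trajectories, such as [S t *m Omega t = 1%:M], come from uniqueness: the difference of the two
    sides vanishes at 0 and solves a linear homogeneous equation whose coefficients are bounded on
    compact intervals. Thus no a priori bound for [Omega] enters. The obstacle in the network is a
    circularity: the forcing of the error system contains [(P i t - Phi i) *m thu i t], which is
    known to decay only once [thu] is bounded, while [thu] is driven by that same error. Boundedness
    is therefore proved beforehand, by an energy estimate whose growth rate is integrable in time.
    The contraction constant of the network depends only on the graph and the projections and is
    chosen before the gains, so that the rate grows with [gamma] and [eta_u]. *)

Lemma ode_cst (c : R) : ode (fun=> c) (fun=> 0).
Proof.
split=> [|t _]; last exact: is_derive_cst.
by apply: continuous_subspaceT => x; exact: cst_continuous.
Qed.

Lemma odeD f g df dg : ode f df -> ode g dg ->
  ode (fun t => f t + g t) (fun t => df t + dg t).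
Proof.
move=> [fc fd] [gc gd]; split=> [x|t t0].
  by apply: continuousD; [exact: fc|exact: gc].
by apply: is_deriveD; [exact: fd|exact: gd].
Qed.

Lemma odeN f df : ode f df -> ode (fun t => - f t) (fun t => - df t).
Proof.
move=> [fc fd]; split=> [x|t t0]; first by apply: continuousN; exact: fc.
by apply: is_deriveN; exact: fd.
Qed.

Lemma odeB f g df dg : ode f df -> ode g dg ->
  ode (fun t => f t - g t) (fun t => df t - dg t).
Proof. by move=> fo go; apply: odeD => //; exact: odeN. Qed.

Lemma odeM f g df dg : ode f df -> ode g dg ->
  ode (fun t => f t * g t) (fun t => df t * g t + f t * dg t).
Proof.
move=> [fc fd] [gc gd]; split=> [x|t t0].
  by apply: continuousM; [exact: fc|exact: gc].
apply: (is_derive_eq (is_deriveM (fd t t0) (gd t t0))).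
by rewrite /GRing.scale/= addrC mulrC.
Qed.

Lemma odeZ (c : R) f df : ode f df ->
  ode (fun t => c * f t) (fun t => c * df t).
Proof.
move=> fo; have := odeM (ode_cst c) fo.
by congr ode; apply/funext => t; rewrite mul0r add0r.
Qed.

Lemma ode_sum (I : Type) (r : seq I) (F dF : I -> R -> R) :
  (forall i, ode (F i) (dF i)) ->
  ode (fun t => \sum_(i <- r) F i t) (fun t => \sum_(i <- r) dF i t).
Proof.
move=> Fo; elim: r => [|i r IH].
  have := ode_cst 0; congr ode; apply/funext => t; by rewrite big_nil.
have := odeD (Fo i) IH.
by congr ode; apply/funext => t; rewrite big_cons.
Qed.

Lemma ode_ext f g df dg : (forall t, f t = g t) ->
  (forall t, 0 < t -> df t = dg t) -> ode f df -> ode g dg.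
Proof.
move=> /funext <- dfg [fc fd]; split=> // t t0.
by rewrite -dfg//; exact: fd.
Qed.

Lemma ode_expR_comp f df : ode f df ->
  ode (fun t => expR (f t)) (fun t => df t * expR (f t)).
Proof.
move=> [fc fd]; split=> [|t t0].
  apply: (@within_continuous_comp _ _ _ _ f expR) => //.
  by move=> x _; exact: continuous_expR.
apply: (is_derive_eq (@is_derive1_comp R expR f t _ _ _ (fd t t0))).
by rewrite mulrC.
Qed.

Lemma ode_expR (k : R) : ode (fun t => expR (k * t)) (fun t => k * expR (k * t)).
Proof.
apply: (ode_expR_comp (f := fun t => k * t) (df := fun=> k)).
split=> [|t _]; first by apply: continuous_subspaceT => t; exact: mulrl_continuous.
by apply: (is_derive_eq (is_deriveZ k (is_derive_id t 1))); exact: mulr1.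
Qed.

Lemma ode_expRN (k : R) :
  ode (fun t => expR (- (k * t))) (fun t => - (k * expR (- (k * t)))).
Proof.
by apply: ode_ext (ode_expR (- k)) => [t|t _]; rewrite ?mulNr.
Qed.

Lemma ode_expM (k : R) f df : ode f df ->
  ode (fun t => expR (k * t) * f t) (fun t => expR (k * t) * (k * f t + df t)).
Proof.
by move=> fo; apply: ode_ext (odeM (ode_expR k) fo) => // t _; ring.
Qed.

Lemma ode_within f df (a b : R) : 0 <= a -> ode f df ->
  {within `[a, b], continuous f}.
Proof.
move=> a0 [fc _]; apply: continuous_subspaceW fc => x /=.
by rewrite !in_itv/= andbT => /andP[ax _]; rewrite (le_trans a0).
Qed.

Lemma ode_le f df (a b : R) : ode f df -> 0 <= a -> a <= b ->
  (forall t, a < t < b -> df t <= 0) -> f b <= f a.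
Proof.
move=> fo a0; rewrite le_eqVlt => /predU1P[->//|ab] dfle.
have [t|c cab E] := @MVT R f df a b ab _ (ode_within a0 fo).
  by rewrite in_itv/= => /andP[ta _]; apply fo.2; exact: le_lt_trans ta.
rewrite -subr_le0 E mulr_le0_ge0 ?subr_ge0 ?(ltW ab)//.
by apply: dfle; move: cab; rewrite in_itv.
Qed.

Lemma ode_ge f df (a b : R) : ode f df -> 0 <= a -> a <= b ->
  (forall t, a < t < b -> 0 <= df t) -> f a <= f b.
Proof.
move=> fo a0 ab dfge; rewrite -lerN2.
by apply: (ode_le (odeN fo) a0 ab) => t /dfge; rewrite oppr_le0.
Qed.

Lemma ode_eq0_const f df (t : R) : ode f df -> 0 <= t ->
  (forall t, 0 < t -> df t = 0) -> f t = f 0.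
Proof.
move=> fo t0 df0; apply/eqP; rewrite eq_le.
by rewrite (ode_le fo)// ?(ode_ge fo)// => s /andP[/df0->].
Qed.

(** With [c = K / (mu - nu)], the function [c * expR (- (nu * t))] solves the equation obtained from
    the differential inequality. Multiplied by [expR (mu * t)], the difference between [f] and this
    solution is nonincreasing. *)
Lemma ode_decay f df (mu nu K : R) : ode f df -> nu < mu -> 0 <= K ->
  (forall t, 0 < t -> df t <= - (mu * f t) + K * expR (- (nu * t))) ->
  forall t, 0 <= t ->
    f t <= (`|f 0| + K / (mu - nu)) * expR (- (nu * t)).
Proof.
move=> fo numu K0 dfle t t0.
have mn : 0 < mu - nu by rewrite subr_gt0.
pose c := K / (mu - nu).
have c0 : 0 <= c by rewrite divr_ge0// ltW.
have cK : c * (mu - nu) = K by rewrite /c divfK// gt_eqF.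
have ho := odeB (ode_expM mu fo) (odeZ c (ode_expR (mu - nu))).
have /= := ode_le ho (lexx 0) t0.
rewrite !mulr0 expR0 mul1r mulr1 => H.
have {}H : expR (mu * t) * f t - c * expR ((mu - nu) * t) <= f 0 - c.
  apply: H => s /andP[s0 _].
  have -> : expR ((mu - nu) * s) = expR (mu * s) * expR (- (nu * s)).
    by rewrite -expRD; congr expR; ring.
  have := dfle s s0; have := expR_gt0 (mu * s); rewrite -cK; nra.
have E1 : expR ((mu - nu) * t) = expR (mu * t) * expR (- (nu * t)).
  by rewrite -expRD; congr expR; ring.
have E2 : 1 <= expR (mu * t) * expR (- (nu * t)).
  by rewrite -E1 -expR0 ler_expR mulr_ge0// ltW.
rewrite -(ler_pM2l (expR_gt0 (mu * t))).
rewrite -/c; have := ler_norm (f 0); have := normr_ge0 (f 0).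
move: H; rewrite E1.
move: (expR (mu * t)) (expR (- (nu * t))) E2 => x y E2 H h1 h2.
have : `|f 0| <= `|f 0| * (x * y) by rewrite ler_peMr.
by lra.
Qed.

Lemma ode_gronwall f df (K b : R) : ode f df -> 0 <= b ->
  (forall t, 0 < t < b -> df t <= K * f t) ->
  f b <= f 0 * expR (K * b).
Proof.
move=> fo b0 dfle.
have := ode_le (ode_expM (- K) fo) (lexx 0) b0.
rewrite mulr0 expR0 mul1r => H.
have {}H : expR (- K * b) * f b <= f 0.
  by apply: H => t /dfle ?; rewrite pmulr_rle0 ?expR_gt0//; lra.
rewrite -(ler_pM2l (expR_gt0 (- K * b))) mulrCA -expRD mulNr addNr expR0 mulr1.
by rewrite -mulNr.
Qed.

(** The entrywise form reduces matrix products, transposes and blocks to scalar calculus. *)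
Definition mxode m n (X F : R -> 'M[R]_(m, n)) :=
  forall i j, ode (fun t => X t i j) (fun t => F t i j).

Section matrix_ode.
Variables m n p : nat.
Implicit Types (X F Y G : R -> 'M[R]_(m, n)).

Lemma ode_mx X F : ode X F -> mxode X F.
Proof.
move=> [Xc Xd] i j; split=> [|t t0].
  apply: (@within_continuous_comp _ _ _ _ X (fun M : 'M[R]_(m, n) => M i j)) => //.
  by move=> M _; exact: coord_continuous.
have [Xdd XF] := Xd t t0; split; first exact: (derivable_mxP X t 1).1.
by rewrite -XF derive_mx// mxE.
Qed.

Lemma mxode_cst (A : 'M[R]_(m, n)) : mxode (fun=> A) (fun=> 0).
Proof. by move=> i j; apply: ode_ext (ode_cst (A i j)) => // t; rewrite mxE. Qed.

Lemma mxodeD X F Y G : mxode X F -> mxode Y G ->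
  mxode (fun t => X t + Y t) (fun t => F t + G t).
Proof.
by move=> Xo Yo i j; apply: ode_ext (odeD (Xo i j) (Yo i j)) => t; rewrite ?mxE.
Qed.

Lemma mxodeN X F : mxode X F -> mxode (fun t => - X t) (fun t => - F t).
Proof.
by move=> Xo i j; apply: ode_ext (odeN (Xo i j)) => t; rewrite ?mxE.
Qed.

Lemma mxodeB X F Y G : mxode X F -> mxode Y G ->
  mxode (fun t => X t - Y t) (fun t => F t - G t).
Proof. by move=> Xo Yo; apply: mxodeD => //; exact: mxodeN. Qed.

Lemma mxodeZ (c dc : R -> R) X F : ode c dc -> mxode X F ->
  mxode (fun t => c t *: X t) (fun t => dc t *: X t + c t *: F t).
Proof.
by move=> co Xo i j; apply: ode_ext (odeM co (Xo i j)) => t; rewrite ?mxE.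
Qed.

Lemma mxodeM X F (Y G : R -> 'M[R]_(n, p)) : mxode X F -> mxode Y G ->
  mxode (fun t => X t *m Y t) (fun t => F t *m Y t + X t *m G t).
Proof.
move=> Xo Yo i j.
apply: ode_ext (ode_sum (index_enum _) (fun k => odeM (Xo i k) (Yo k j))) => t.
  by rewrite mxE.
by rewrite !mxE -big_split.
Qed.

Lemma mxodeMl (A : 'M[R]_(p, m)) X F : mxode X F ->
  mxode (fun t => A *m X t) (fun t => A *m F t).
Proof.
move=> Xo i j.
apply: ode_ext (ode_sum (index_enum _) (fun k => odeZ (A i k) (Xo k j))) => t;
  by rewrite mxE.
Qed.

Lemma mxodeMr (A : 'M[R]_(n, p)) X F : mxode X F ->
  mxode (fun t => X t *m A) (fun t => F t *m A).
Proof.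
move=> Xo i j.
apply: ode_ext (ode_sum (index_enum _) (fun k => odeZ (A k j) (Xo i k))) => t;
  by move=> *; rewrite mxE; apply: eq_bigr => k _; rewrite mulrC.
Qed.

Lemma mxode_tr X F : mxode X F -> mxode (fun t => (X t)^T) (fun t => (F t)^T).
Proof. by move=> Xo i j; apply: ode_ext (Xo j i) => t; rewrite mxE. Qed.

Lemma mxode_ext X F Y G : (forall t, X t = Y t) ->
  (forall t, 0 < t -> F t = G t) -> mxode X F -> mxode Y G.
Proof.
by move=> XY FG Xo i j; apply: ode_ext (Xo i j) => t; rewrite ?XY// => /FG->.
Qed.

End matrix_ode.

End ode_calculus.

(** * Euclidean product and exponential order *)

Section dot_product.
Variables (R : realType) (n : nat).
Implicit Types (u v w : 'cV[R]_n) (A : 'M[R]_n).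

Lemma dotvE u v : dotv u v = \sum_i u i 0 * v i 0.
Proof. by rewrite /dotv mxE; apply: eq_bigr => i _; rewrite mxE. Qed.

Lemma dotvC u v : dotv u v = dotv v u.
Proof. by rewrite !dotvE; apply: eq_bigr => i _; rewrite mulrC. Qed.

Lemma dotvDr u v w : dotv u (v + w) = dotv u v + dotv u w.
Proof. by rewrite /dotv mulmxDr mxE. Qed.

Lemma dotvDl u v w : dotv (u + v) w = dotv u w + dotv v w.
Proof. by rewrite !(dotvC _ w) dotvDr. Qed.

Lemma dotvNr u v : dotv u (- v) = - dotv u v.
Proof. by rewrite /dotv mulmxN mxE. Qed.

Lemma dotvNl u v : dotv (- u) v = - dotv u v.
Proof. by rewrite !(dotvC _ v) dotvNr. Qed.

Lemma dotvBr u v w : dotv u (v - w) = dotv u v - dotv u w.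
Proof. by rewrite dotvDr dotvNr. Qed.

Lemma dotvBl u v w : dotv (u - v) w = dotv u w - dotv v w.
Proof. by rewrite dotvDl dotvNl. Qed.

Lemma dotvZr (c : R) u v : dotv u (c *: v) = c * dotv u v.
Proof. by rewrite /dotv -scalemxAr mxE. Qed.

Lemma dotvZl (c : R) u v : dotv (c *: u) v = c * dotv u v.
Proof. by rewrite !(dotvC _ v) dotvZr. Qed.

Lemma dotv0 u : dotv u 0 = 0.
Proof. by rewrite /dotv mulmx0 mxE. Qed.

Lemma dotv_sumr (I : Type) (r : seq I) (F : I -> 'cV[R]_n) u :
  dotv u (\sum_(i <- r) F i) = \sum_(i <- r) dotv u (F i).
Proof.
elim: r => [|i r IH]; first by rewrite !big_nil dotv0.
by rewrite !big_cons dotvDr IH.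
Qed.

Lemma dotv_mull A u v : dotv (A *m u) v = dotv u (A^T *m v).
Proof. by rewrite /dotv trmx_mul -mulmxA. Qed.

Lemma dotv_mulr A u v : dotv u (A *m v) = dotv (A^T *m u) v.
Proof. by rewrite dotv_mull trmxK. Qed.

Lemma dotvv_ge0 v : 0 <= dotv v v.
Proof. by rewrite dotvE sumr_ge0// => i _; rewrite -expr2 sqr_ge0. Qed.

Lemma sqr_le_dotvv v i : v i 0 ^+ 2 <= dotv v v.
Proof.
rewrite dotvE (bigD1 i)//= -expr2 lerDl sumr_ge0// => j _.
by rewrite -expr2 sqr_ge0.
Qed.

Lemma dotvv_eq0 v : dotv v v = 0 -> v = 0.
Proof.
move=> v0; apply/matrixP => i j; rewrite (ord1 j) mxE.
by apply/eqP; rewrite -sqrf_eq0 eq_le sqr_ge0 andbT -v0 sqr_le_dotvv.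
Qed.

Lemma dotv_young (c : R) u v : 0 < c ->
  2 * dotv u v <= c * dotv u u + c^-1 * dotv v v.
Proof.
move=> c0; have := dotvv_ge0 (c *: u - v).
rewrite dotvBl !dotvBr !dotvZl !dotvZr (dotvC v u).
have E : c * (c^-1 * dotv v v) = dotv v v by rewrite mulrA divff ?mul1r ?gt_eqF.
by move=> H; rewrite -(ler_pM2l c0); lra.
Qed.

End dot_product.

Section exponential_order.
Variable R : realType.
Implicit Types (D : set R) (f g : R -> R) (rho sigma : R).

(** The rate may have any sign. The domain [D] is a parameter so that an initial interval and a tail
    can be treated separately. *)
Definition sexpO D rho f :=
  exists C, forall t, D t -> `|f t| <= C * expR (- (rho * t)).

Definition expO D rho m n (X : R -> 'M[R]_(m, n)) :=
  forall i j, sexpO D rho (fun t => X t i j).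

Definition nonneg_times : set R := [set t | 0 <= t].

Lemma sexpO_pos D rho f : sexpO D rho f ->
  exists2 C, 0 < C & forall t, D t -> `|f t| <= C * expR (- (rho * t)).
Proof.
move=> [C fC]; exists (`|C| + 1) => [|t /fC fle]; first by rewrite ltr_wpDl.
apply: (le_trans fle); rewrite ler_pM2r ?expR_gt0//.
by rewrite (le_trans (ler_norm C))// lerDl.
Qed.

Lemma sexpO_ext D rho f g : (forall t, D t -> f t = g t) ->
  sexpO D rho f -> sexpO D rho g.
Proof. by move=> fg [C fC]; exists C => t Dt; rewrite -fg// fC. Qed.

Lemma sexpO_sub D D' rho f : D' `<=` D -> sexpO D rho f -> sexpO D' rho f.
Proof. by move=> DD [C fC]; exists C => t /DD; exact: fC. Qed.

Lemma sexpO_weak D rho sigma f : (forall t, D t -> 0 <= t) -> sigma <= rho ->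
  sexpO D rho f -> sexpO D sigma f.
Proof.
move=> D0 sr /sexpO_pos[C C0 fC]; exists C => t Dt.
apply: (le_trans (fC t Dt)); rewrite ler_pM2l// ler_expR lerN2.
by rewrite ler_wpM2r// D0.
Qed.

Lemma sexpO_le D rho f g : (forall t, D t -> `|f t| <= `|g t|) ->
  sexpO D rho g -> sexpO D rho f.
Proof.
by move=> fg [C gC]; exists C => t Dt; exact: le_trans (fg t Dt) (gC t Dt).
Qed.

Lemma sexpO_cst D c : sexpO D 0 (fun=> c).
Proof. by exists `|c| => t _; rewrite mul0r oppr0 expR0 mulr1. Qed.

Lemma sexpO0 D rho : sexpO D rho (fun=> 0).
Proof. by exists 0 => t _; rewrite normr0 mul0r. Qed.

Lemma sexpO_expR D rho : sexpO D rho (fun t => expR (- (rho * t))).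
Proof. by exists 1 => t _; rewrite mul1r ger0_norm// expR_ge0. Qed.

Lemma sexpO_bounded D c f : (forall t, D t -> `|f t| <= c) -> sexpO D 0 f.
Proof. by move=> fc; exists c => t Dt; rewrite mul0r oppr0 expR0 mulr1 fc. Qed.

Lemma sexpOD D rho f g : sexpO D rho f -> sexpO D rho g ->
  sexpO D rho (fun t => f t + g t).
Proof.
move=> [C fC] [K gK]; exists (C + K) => t Dt.
by rewrite mulrDl (le_trans (ler_normD _ _))// lerD ?fC ?gK.
Qed.

Lemma sexpON D rho f : sexpO D rho f -> sexpO D rho (fun t => - f t).
Proof. by apply: sexpO_le => t _; rewrite normrN. Qed.

Lemma sexpOM D rho sigma f g : sexpO D rho f -> sexpO D sigma g ->
  sexpO D (rho + sigma) (fun t => f t * g t).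
Proof.
move=> [C fC] [K gK]; exists (C * K) => t Dt.
rewrite mulrDl opprD expRD mulrACA normrM.
by apply: ler_pM => //; [exact: fC|exact: gK].
Qed.

Lemma sexpOMr D rho f g : sexpO D 0 f -> sexpO D rho g ->
  sexpO D rho (fun t => f t * g t).
Proof. by move=> f0 gr; have := sexpOM f0 gr; rewrite add0r. Qed.

Lemma sexpO_sum D rho (I : Type) (r : seq I) (F : I -> R -> R) :
  (forall i, sexpO D rho (F i)) -> sexpO D rho (fun t => \sum_(i <- r) F i t).
Proof.
move=> FO; elim: r => [|i r IH].
  by apply: sexpO_ext (sexpO0 D rho) => t _; rewrite big_nil.
by apply: sexpO_ext (sexpOD (FO i) IH) => t _; rewrite big_cons.
Qed.

Lemma sexpO_sqr D rho f g : (forall t, D t -> f t ^+ 2 <= g t) ->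
  sexpO D (rho + rho) g -> sexpO D rho f.
Proof.
(* [C + 1] stands in for the square root of [C], since [C <= (C + 1) ^+ 2]. *)
move=> fg /sexpO_pos[C C0 gC]; exists (C + 1) => t Dt.
have C1 : 0 <= C + 1 by lra.
rewrite -(@ler_pXn2r _ 2)// ?nnegrE// ?mulr_ge0 ?expR_ge0// real_normK ?num_real//.
apply: (le_trans (fg t Dt)); apply: (le_trans (ler_norm _)).
apply: (le_trans (gC t Dt)).
rewrite exprMn [expR _ ^+ 2]expr2 -expRD -opprD -mulrDl.
by rewrite ler_pM2r ?expR_gt0//; nra.
Qed.

(** On the initial interval the weight [expR (- (rho * t))] is at least [expR (- (]|rho| * [|b|))]
    whatever the sign of [rho], so enlarging the constant by the inverse factor absorbs a bounded
    piece. *)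
Lemma sexpO_glue rho f b : sexpO [set t | 0 <= t <= b] 0 f ->
  sexpO [set t | b <= t] rho f -> sexpO nonneg_times rho f.
Proof.
move=> /sexpO_pos[C C0 fC] /sexpO_pos[K K0 fK].
exists (C * expR (`|rho| * `|b|) + K) => t t0; rewrite mulrDl.
have [bt|tb] := leP b t.
  by rewrite (le_trans (fK t bt))// lerDr !mulr_ge0 ?expR_ge0 ?ltW.
have := fC t; rewrite /= t0 ltW// mul0r oppr0 expR0 mulr1 => /(_ isT) fle.
apply: (le_trans fle); rewrite -mulrA -expRD.
apply: (@le_trans _ _ (C * expR (`|rho| * `|b| - rho * t))); last first.
  by rewrite lerDl mulr_ge0 ?expR_ge0 ?ltW.
rewrite ler_peMr ?(ltW C0)// -[leLHS]expR0 ler_expR subr_ge0.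
apply: (le_trans (ler_norm _)); rewrite normrM ler_wpM2l//.
by rewrite (ger0_norm t0) (le_trans (ltW tb))// ler_norm.
Qed.

Lemma sexpO_ode f df b : ode f df -> sexpO [set t | 0 <= t <= b] 0 f.
Proof.
move=> fo; have [b0|b0] := leP 0 b; last first.
  by exists 0 => t /=/andP[t0 tb]; have := le_trans t0 tb; rewrite leNgt b0.
have cf : {within `[0, b], continuous (fun t => `|f t|)}.
  apply: (@within_continuous_comp _ _ _ _ f (fun x => `|x|)).
    by move=> x _; exact: norm_continuous.
  exact: ode_within fo.
have [c _ fc] := EVT_max b0 cf.
apply: (@sexpO_bounded _ `|f c|) => t tb; apply: fc.
by rewrite in_itv.
Qed.

(** A first order filter passes on the rate of its input as long as that rate stays below its own
    rate [mu]. The bound on the absolute value comes from comparing both [f] and [- f]. *)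
Lemma sexpO_filter f df mu rho : ode f df -> rho < mu ->
  sexpO nonneg_times rho (fun t => df t + mu * f t) -> sexpO nonneg_times rho f.
Proof.
move=> fo rm /sexpO_pos[C C0 fC].
have H g dg : ode g dg ->
    (forall t, 0 <= t -> `|dg t + mu * g t| <= C * expR (- (rho * t))) ->
    exists K, forall t, 0 <= t -> g t <= K * expR (- (rho * t)).
  move=> go gC; exists (`|g 0| + C / (mu - rho)); apply: (ode_decay go) => //.
    exact: ltW.
  by move=> t t0; have := le_trans (ler_norm _) (gC t (ltW t0)); lra.
have [K1 H1] := H _ _ fo fC.
have [t t0|K2 H2] := H _ _ (odeN fo).
  by rewrite mulrN -opprD normrN; exact: fC.
exists (`|K1| + `|K2|) => t t0; rewrite ler_norml; apply/andP; split.
  rewrite lerNl (le_trans (H2 t t0))// ler_pM2r ?expR_gt0//.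
  by rewrite (le_trans (ler_norm _))// lerDr.
rewrite (le_trans (H1 t t0))// ler_pM2r ?expR_gt0//.
by rewrite (le_trans (ler_norm _))// lerDl.
Qed.

Section matrix_order.
Variables (D : set R) (m n p : nat).
Implicit Types (X Y : R -> 'M[R]_(m, n)).

Lemma expO_ext rho X Y : (forall t, D t -> X t = Y t) ->
  expO D rho X -> expO D rho Y.
Proof. by move=> XY XO i j; apply: sexpO_ext (XO i j) => t Dt; rewrite XY. Qed.

Lemma expO_weak rho sigma X : (forall t, D t -> 0 <= t) -> sigma <= rho ->
  expO D rho X -> expO D sigma X.
Proof. by move=> D0 sr XO i j; exact: sexpO_weak (XO i j). Qed.

Lemma expO_cst (A : 'M[R]_(m, n)) : expO D 0 (fun=> A).
Proof. by move=> i j; exact: sexpO_cst. Qed.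

Lemma expO0 rho : expO D rho (fun=> 0 : 'M[R]_(m, n)).
Proof. by move=> i j; apply: sexpO_ext (sexpO0 D rho) => t; rewrite mxE. Qed.

Lemma expOD rho X Y : expO D rho X -> expO D rho Y ->
  expO D rho (fun t => X t + Y t).
Proof.
by move=> XO YO i j; apply: sexpO_ext (sexpOD (XO i j) (YO i j)) => t; rewrite mxE.
Qed.

Lemma expON rho X : expO D rho X -> expO D rho (fun t => - X t).
Proof. by move=> XO i j; apply: sexpO_ext (sexpON (XO i j)) => t; rewrite mxE. Qed.

Lemma expOB rho X Y : expO D rho X -> expO D rho Y ->
  expO D rho (fun t => X t - Y t).
Proof. by move=> XO YO; apply: expOD => //; exact: expON. Qed.

Lemma expOZ rho sigma (c : R -> R) X : sexpO D rho c -> expO D sigma X ->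
  expO D (rho + sigma) (fun t => c t *: X t).
Proof.
by move=> cO XO i j; apply: sexpO_ext (sexpOM cO (XO i j)) => t; rewrite mxE.
Qed.

Lemma expOZr rho (c : R -> R) X : sexpO D 0 c -> expO D rho X ->
  expO D rho (fun t => c t *: X t).
Proof. by move=> cO XO; have := expOZ cO XO; rewrite add0r. Qed.

Lemma expOZl rho (c : R -> R) X : sexpO D rho c -> expO D 0 X ->
  expO D rho (fun t => c t *: X t).
Proof. by move=> cO XO; have := expOZ cO XO; rewrite addr0. Qed.

Lemma expOM rho sigma X (Y : R -> 'M[R]_(n, p)) : expO D rho X ->
  expO D sigma Y -> expO D (rho + sigma) (fun t => X t *m Y t).
Proof.
move=> XO YO i j.
apply: sexpO_ext (sexpO_sum (index_enum _) (fun k => sexpOM (XO i k) (YO k j))).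
by move=> t _; rewrite mxE.
Qed.

Lemma expOMl rho X (Y : R -> 'M[R]_(n, p)) : expO D rho X ->
  expO D 0 Y -> expO D rho (fun t => X t *m Y t).
Proof. by move=> XO YO; have := expOM XO YO; rewrite addr0. Qed.

Lemma expOMr rho X (Y : R -> 'M[R]_(n, p)) : expO D 0 X ->
  expO D rho Y -> expO D rho (fun t => X t *m Y t).
Proof. by move=> XO YO; have := expOM XO YO; rewrite add0r. Qed.

Lemma expO_tr rho X : expO D rho X -> expO D rho (fun t => (X t)^T).
Proof. by move=> XO i j; apply: sexpO_ext (XO j i) => t; rewrite mxE. Qed.

Lemma expO_sum rho (I : Type) (r : seq I) (F : I -> R -> 'M[R]_(m, n)) :
  (forall i, expO D rho (F i)) -> expO D rho (fun t => \sum_(i <- r) F i t).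
Proof.
move=> FO; elim: r => [|i r IH].
  by apply: expO_ext (expO0 rho) => t _; rewrite big_nil.
by apply: expO_ext (expOD (FO i) IH) => t _; rewrite big_cons.
Qed.

End matrix_order.

Lemma expO_sub D D' rho m n (X : R -> 'M[R]_(m, n)) :
  D' `<=` D -> expO D rho X -> expO D' rho X.
Proof. by move=> DD XO i j; exact: sexpO_sub (XO i j). Qed.

Lemma expO_filter m n (X F : R -> 'M[R]_(m, n)) mu rho : mxode X F -> rho < mu ->
  expO nonneg_times rho (fun t => F t + mu *: X t) -> expO nonneg_times rho X.
Proof.
move=> Xo rm FO i j; apply: (sexpO_filter (Xo i j) rm).
by apply: sexpO_ext (FO i j) => t _; rewrite !mxE.
Qed.

Lemma sexpO_dotv D rho sigma n (u v : R -> 'cV[R]_n) : expO D rho u ->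
  expO D sigma v -> sexpO D (rho + sigma) (fun t => dotv (u t) (v t)).
Proof. by move=> uO vO; exact: (expOM (expO_tr uO) vO 0 0). Qed.

(** Used with [g = M v] for a coercive family [M]: Young's inequality bounds the norm of [v] by
    [c^-1] times that of [g], so the solution of a linear system inherits the rate of its right-hand
    side and no inverse is formed. *)
Lemma expO_coercive D rho c n (v g : R -> 'cV[R]_n) : 0 < c ->
  (forall t, D t -> c * dotv (v t) (v t) <= dotv (v t) (g t)) ->
  expO D rho g -> expO D rho v.
Proof.
move=> c0 vg gO i j; rewrite (ord1 j).
apply: (@sexpO_sqr _ _ _ (fun t => c^-1 ^+ 2 * dotv (g t) (g t))) => [t Dt|].
  apply: (le_trans (sqr_le_dotvv _ _)).
  have := vg t Dt; have := dotv_young (v t) (g t) c0.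
  move=> H1 H2; rewrite -(ler_pM2l c0).
  have -> : c * (c^-1 ^+ 2 * dotv (g t) (g t)) = c^-1 * dotv (g t) (g t).
    by field; rewrite gt_eqF.
  by lra.
by apply: sexpOMr; [exact: sexpO_cst|exact: sexpO_dotv].
Qed.

Lemma expO_dotvv D rho n (v : R -> 'cV[R]_n) :
  sexpO D (rho + rho) (fun t => dotv (v t) (v t)) -> expO D rho v.
Proof.
by move=> vO i j; rewrite (ord1 j); apply: sexpO_sqr vO => t _; exact: sqr_le_dotvv.
Qed.

Lemma sexpO_enorm D rho n (v : R -> 'cV[R]_n) : expO D rho v ->
  sexpO D rho (fun t => enorm (v t)).
Proof.
move=> vO; apply: (@sexpO_sqr _ _ _ (fun t => dotv (v t) (v t))).
  move=> t _; rewrite /enorm sqr_sqrtr; last by rewrite sumr_ge0// => i; rewrite sqr_ge0.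
  by rewrite dotvE.
exact: sexpO_dotv.
Qed.

Lemma expO_enorm D rho n (v : R -> 'cV[R]_n) :
  sexpO D rho (fun t => enorm (v t)) -> expO D rho v.
Proof.
move=> vO i j; rewrite (ord1 j); apply: sexpO_le vO => t _.
rewrite [leRHS]ger0_norm ?sqrtr_ge0// -sqrtr_sqr ler_wsqrtr//.
by rewrite (le_trans (sqr_le_dotvv (v t) i))// dotvE.
Qed.

End exponential_order.

(** * Projections and strongly connected graphs *)

Section linear_algebra_lemmas.
Variable R : realType.

Lemma sum_norm_entry_ge0 m n (A : 'M[R]_(m, n)) : 0 <= \sum_i \sum_j `|A i j|.
Proof. by apply: sumr_ge0 => i _; apply: sumr_ge0. Qed.

Lemma dotv_mx_le n (A : 'M[R]_n) (v : 'cV[R]_n) :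
  `|dotv v (A *m v)| <= (\sum_i \sum_j `|A i j|) * dotv v v.
Proof.
rewrite dotvE mulr_suml (le_trans (ler_norm_sum _ _ _))// ler_sum// => i _.
rewrite mxE mulr_sumr mulr_suml (le_trans (ler_norm_sum _ _ _))// ler_sum// => j _.
have -> : v i 0 * (A i j * v j 0) = A i j * (v i 0 * v j 0) by ring.
rewrite normrM ler_wpM2l//.
have := sqr_le_dotvv v i; have := sqr_le_dotvv v j.
rewrite -(real_normK (num_real (v i 0))) -(real_normK (num_real (v j 0))) normrM.
have := normr_ge0 (v i 0); have := normr_ge0 (v j 0); nra.
Qed.

(** Neither compactness nor the spectral theorem is used. With [B] the inverse of [A] and [K] a
    bound of its quadratic form, nonnegativity of the form of [A] at [K *: v - B *m v] expands to an
    inequality that gives [dotv v v <= K * dotv v (A *m v)]. *)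
Lemma posdef_coercive n (A : 'M[R]_n) : posdef A ->
  exists2 c, 0 < c & forall v : 'cV[R]_n, c * dotv v v <= dotv v (A *m v).
Proof.
move=> [Asym Apos].
have Age0 v : 0 <= dotv v (A *m v).
  by have [->|/Apos/ltW//] := eqVneq v 0; rewrite mulmx0 dotv0.
have Aunit : A \in unitmx.
  rewrite unitmxE unitfE; apply/negP => /det0P[v v0 vA].
  have /Apos : v^T != 0 by rewrite -trmx0 (inj_eq trmx_inj).
  by rewrite -{1}Asym -trmx_mul vA trmx0 dotv0 ltxx.
set B := invmx A; pose K := \sum_i \sum_j `|B i j| + 1.
have K0 : 0 < K by rewrite ltr_wpDl// sum_norm_entry_ge0.
exists K^-1; first by rewrite invr_gt0.
move=> v; rewrite mulrC ler_pdivrMr//.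
have := Age0 (K *: v - B *m v).
have AB : A *m (B *m v) = v by rewrite mulmxA mulmxV// mul1mx.
rewrite mulmxBr -scalemxAr AB dotvBl !dotvBr !dotvZl !dotvZr.
rewrite (dotvC (B *m v) (A *m v)) dotv_mull Asym AB (dotvC (B *m v) v).
have : dotv v (B *m v) <= K * dotv v v.
  apply: (le_trans (ler_norm _)); apply: (le_trans (dotv_mx_le _ _)).
  by rewrite ler_wpM2r ?dotvv_ge0// lerDl.
move=> H1 H2; rewrite -(ler_pM2l K0); lra.
Qed.

Lemma orthonormal_proj n k (B : 'M[R]_(n, k)) (A : 'M[R]_n) :
  orthogonal_projection A -> B^T *m B = 1%:M -> (B^T == A)%MS -> B *m B^T = A.
Proof.
move=> [AA Asym] BB /andP[/submxP[D BD] /submxP[F AF]].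
have BA : B^T *m A = B^T by rewrite BD -mulmxA AA.
have AB : A *m B = B by apply: trmx_inj; rewrite trmx_mul Asym.
by rewrite -{1}AB -mulmxA {1}AF -!mulmxA (mulmxA B^T) BB mul1mx -AF.
Qed.

Lemma orthogonal_projectionC n (A : 'M[R]_n) :
  orthogonal_projection A -> orthogonal_projection (1%:M - A).
Proof.
move=> [AA Asym]; split; last by rewrite linearB/= trmx1 Asym.
by rewrite mulmxBr mulmx1 mulmxBl mul1mx AA subrr subr0.
Qed.

(** The two conditions on [Q] are the two inclusions between the kernels of [Q] and [A], and
    [1%:M - A] projects onto the latter. This identifies the projections built from the sampled
    kernel bases and from [Nu]. *)
Lemma orthonormal_ker_proj n k (Q A : 'M[R]_n) (B : 'M[R]_(n, k)) :
  orthogonal_projection A -> orthonormal_basis_ker Q B ->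
  Q *m (1%:M - A) = 0 -> (forall v : 'cV[R]_n, Q *m v = 0 -> A *m v = 0) ->
  B *m B^T = 1%:M - A.
Proof.
move=> Aproj [BB Bker] QA QvA; have [AA Asym] := Aproj.
apply: orthonormal_proj => //; first exact: orthogonal_projectionC.
have CA : (kermx Q^T == 1%:M - A)%MS.
  apply/andP; split; last first.
    apply/sub_kermxP; apply: trmx_inj; rewrite trmx_mul trmxK trmx0.
    by rewrite linearB/= trmx1 Asym.
  apply/submxP; exists (kermx Q^T); rewrite mulmxBr mulmx1.
  suff -> : kermx Q^T *m A = 0 by rewrite subr0.
  apply: trmx_inj; rewrite trmx_mul trmx0 Asym.
  have H : Q *m (kermx Q^T)^T = 0.
    by apply: trmx_inj; rewrite trmx_mul trmxK mulmx_ker trmx0.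
  apply/matrixP => i j; have /QvA/matrixP/(_ i 0) : Q *m col j (kermx Q^T)^T = 0.
    by rewrite colE mulmxA H mul0mx.
  by rewrite colE mulmxA -colE !mxE.
move/andP: Bker => [b1 b2]; move/andP: CA => [c1 c2].
by rewrite /eqmx/=; apply/andP; split; [exact: submx_trans b1 c1|exact: submx_trans c2 b2].
Qed.

(** A diagonal entry is the sum of the squares of its row, so it dominates its own square and is at
    most 1; it also dominates the square of every entry of the row. This controls the samples taken
    before the kernel of the Gramian has settled. *)
Lemma proj_entry_le1 n (A : 'M[R]_n) i j : orthogonal_projection A ->
  `|A i j| <= 1.
Proof.
move=> [AA Asym].
have AE : A i i = \sum_k A i k ^+ 2.
  rewrite -{1}AA mxE; apply: eq_bigr => k _.
  by rewrite expr2 -{2}Asym mxE.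
have le k : A i k ^+ 2 <= A i i.
  by rewrite AE (bigD1 k)//= lerDl sumr_ge0// => l _; rewrite sqr_ge0.
have Aii : A i i <= 1 by have := le i; nra.
rewrite -(@ler_pXn2r _ 2)// ?nnegrE// expr1n real_normK ?num_real//.
exact: le_trans (le j) Aii.
Qed.

Lemma orthogonal_projectionBB n k (B : 'M[R]_(n, k)) : B^T *m B = 1%:M ->
  orthogonal_projection (B *m B^T).
Proof.
move=> BB; split; last by rewrite trmx_mul trmxK.
by rewrite -mulmxA (mulmxA B^T) BB mul1mx.
Qed.

End linear_algebra_lemmas.

Section graph_lemmas.
Variables (R : realType) (N : nat) (E : rel 'I_N) (a : 'M[R]_N).
Hypotheses (wa : weighted_adjacency E a) (sc : strongly_connected E).

Lemma weighted_adjacency_ge0 i j : 0 <= a i j.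
Proof.
have [ap a0 _] := wa; have [/ap/ltW//|/a0->//] := boolP (E j i).
Qed.

(* If xi is a left null vector of the Laplacian, so is its absolute value, and
   strong connectivity propagates the vanishing of one entry to all of them. *)
Lemma laplacian_left_null : exists xi : 'I_N -> R, (forall i, 0 < xi i) /\
  forall j, xi j * \sum_k a j k = \sum_i xi i * a i j.
Proof.
have [N0|Npos] := posnP N.
  by exists (fun=> 1); split=> [//|j]; exfalso; have := ltn_ord j; rewrite [X in (_ < X)%N]N0.
pose i0 := Ordinal Npos.
have /eqP/det0P[v v0 vL] : \det (laplacian a) = 0.
  rewrite -det_tr; apply/eqP/det0P; exists (const_mx 1).
    by apply/eqP => /matrixP/(_ 0 i0)/eqP; rewrite !mxE oner_eq0.
  apply/matrixP => i j; rewrite !mxE (bigD1 j)//= !mxE eqxx mul1r (bigD1 j)//=.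
  have [_ _ ->] := wa; rewrite add0r; apply/eqP; rewrite addr_eq0 -sumrN; apply/eqP.
  by apply: eq_bigr => k kj; rewrite !mxE mul1r eq_sym (negbTE kj) opprK.
have vE j : v 0 j * \sum_k a j k = \sum_i v 0 i * a i j.
  move/matrixP/(_ 0 j): vL; rewrite !mxE (bigD1 j)//= mxE eqxx => /eqP.
  rewrite addr_eq0 -sumrN => /eqP->; rewrite [RHS](bigD1 j)//=.
  have [_ _ ->] := wa; rewrite mulr0 add0r; apply: eq_bigr => k kj.
  by rewrite mxE (negbTE kj) mulrN opprK.
have dge0 j : 0 <= \sum_k a j k.
  by apply: sumr_ge0 => k _; exact: weighted_adjacency_ge0.
have absle j : `|v 0 j| * \sum_k a j k <= \sum_i `|v 0 i| * a i j.
  rewrite -{1}(ger0_norm (dge0 j)) -normrM vE (le_trans (ler_norm_sum _ _ _))//.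
  apply: ler_sum => i _.
  by rewrite normrM (ger0_norm (weighted_adjacency_ge0 i j)).
(* The inequalities [absle] are all equalities, because their two sides have the same sum over
   [j]. *)
have absE j : `|v 0 j| * \sum_k a j k = \sum_i `|v 0 i| * a i j.
  have S : \sum_j (\sum_i `|v 0 i| * a i j - `|v 0 j| * \sum_k a j k) = 0.
    rewrite sumrB exchange_big/=; apply/eqP; rewrite subr_eq0; apply/eqP.
    by apply: eq_bigr => i _; rewrite mulr_sumr.
  move/eqP: S; rewrite psumr_eq0 => [/allP/(_ j)|k _]; last first.
    by rewrite subr_ge0.
  by rewrite mem_index_enum => /(_ isT)/=; rewrite subr_eq0 => /eqP.
exists (fun i => `|v 0 i|); split=> // i; rewrite normr_gt0.
apply/eqP => vi0; case/negP: v0; apply/eqP/matrixP => k j.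
rewrite (ord1 k) mxE {k}.
have edge x y : v 0 x = 0 -> E x y -> v 0 y = 0.
  move=> vx Exy; have := absE x; rewrite vx normr0 mul0r => /esym/eqP.
  rewrite psumr_eq0 => [/allP/(_ y)|k _]; last first.
    by rewrite mulr_ge0// weighted_adjacency_ge0.
  rewrite mem_index_enum => /(_ isT)/=; rewrite mulf_eq0 normr_eq0.
  by have [/(_ _ _ Exy)/gt_eqF-> _ _] := wa; rewrite orbF => /eqP.
have /connectP[p] := sc i j.
elim: p i vi0 => [|y p IH] x vx0 /=; first by move=> _ ->.
by move=> /andP[xy yp] jE; apply: IH yp jE; exact: edge xy.
Qed.

Variables (n : nat) (xi : 'I_N -> R) (Phi : 'I_N -> 'M[R]_n).
Hypothesis xi_gt0 : forall i, 0 < xi i.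
Implicit Type y : 'I_N -> 'cV[R]_n.

Definition disagreement y : R :=
  \sum_i \sum_j xi i * a i j * dotv (y i - y j) (y i - y j).

Lemma disagreement_ge0 y : 0 <= disagreement y.
Proof.
apply: sumr_ge0 => i _; apply: sumr_ge0 => j _.
by rewrite !mulr_ge0 ?dotvv_ge0 ?weighted_adjacency_ge0 ?ltW.
Qed.

(** By polarization, twice the product of [y i] with [y i - y j] is the squared distance plus the
    difference of the squared norms of [y i] and [y j]. Weighted by [xi i * a i j], these
    differences sum to zero, because [xi] is a left null vector of the Laplacian. *)
Lemma disagreementE y :
  (forall j, xi j * \sum_k a j k = \sum_i xi i * a i j) ->
  disagreement y =
    2 * \sum_i xi i * dotv (y i) (\sum_j a i j *: (y i - y j)).
Proof.
move=> xiE; apply/eqP; rewrite -subr_eq0 mulr_sumr -sumrB.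
rewrite [X in X == _](_ : _ = \sum_i \sum_j xi i * a i j *
    (dotv (y j) (y j) - dotv (y i) (y i))); last first.
  apply: eq_bigr => i _; rewrite dotv_sumr 2!mulr_sumr -sumrB.
  apply: eq_bigr => j _; rewrite dotvZr !dotvBr !dotvBl (dotvC (y j) (y i)).
  by ring.
under eq_bigr do under eq_bigr do rewrite mulrBr.
under eq_bigr do rewrite sumrB.
rewrite sumrB exchange_big/= subr_eq0; apply/eqP; apply: eq_bigr => i _.
by rewrite -!mulr_suml -mulr_sumr xiE.
Qed.

Let dominated (f : ('I_N -> 'cV[R]_n) -> R) := exists2 C, 0 <= C &
  forall y, (forall i, Phi i *m y i = 0) -> f y <= C * disagreement y.

Lemma dominated_sum (I : Type) (r : seq I) F : (forall i, dominated (F i)) ->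
  dominated (fun y => \sum_(i <- r : seq I) F i y).
Proof.
move=> dF; elim: r => [|i r [C C0 IH]].
  by exists 0 => // y _; rewrite big_nil mul0r.
have [K K0 FK] := dF i; exists (K + C) => [|y y0]; first exact: addr_ge0.
by rewrite big_cons mulrDl lerD ?FK ?IH.
Qed.

(** An edge term is a summand of the disagreement, and along a directed path differences add up, so
    every [y i - y j] is dominated. The vectors themselves follow because [Phi j *m y j = 0]: the
    form of [Phi j] takes the same value at [y i] and at [y i - y j], and the sum of the [Phi j] is
    coercive. *)
Lemma disagreement_coercive : (forall i, orthogonal_projection (Phi i)) ->
  posdef (\sum_i Phi i) ->
  exists2 c, 0 < c & forall y, (forall i, Phi i *m y i = 0) ->
    c * \sum_i dotv (y i) (y i) <= disagreement y.
Proof.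
move=> Pproj Ppos.
have edge i j : E i j ->
    dominated (fun y => dotv (y i - y j) (y i - y j)).
  move=> Eij; have [/(_ _ _ Eij) aji _ _] := wa.
  have xa : 0 < xi j * a j i by rewrite mulr_gt0.
  exists (xi j * a j i)^-1 => [|y _]; first by rewrite invr_ge0 ltW.
  rewrite mulrC ler_pdivlMr// mulrC /disagreement (bigD1 j)//= (bigD1 i)//=.
  have -> : dotv (y i - y j) (y i - y j) = dotv (y j - y i) (y j - y i).
    by rewrite -(opprB (y j)) dotvNl dotvNr opprK.
  rewrite -addrA lerDl addr_ge0// sumr_ge0// => k _; last rewrite sumr_ge0// => l _;
    by rewrite !mulr_ge0 ?dotvv_ge0 ?weighted_adjacency_ge0 ?ltW.
have pair i j : dominated (fun y => dotv (y i - y j) (y i - y j)).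
  have /connectP[p] := sc i j; elim: p i => [|k p IH] i /=.
    by move=> _ ->; exists 0 => // y _; rewrite subrr dotv0 mul0r.
  move=> /andP[/edge[C C0 ik]] kp jE; have [K K0 kj] := IH k kp jE.
  exists (2 * C + 2 * K) => [|y y0]; first by lra.
  have := ik y y0; have := kj y y0.
  have := dotvv_ge0 ((y i - y k) - (y k - y j)).
  have -> : y i - y j = (y i - y k) + (y k - y j) by rewrite addrA subrK.
  move: (y i - y k) (y k - y j) => u w.
  by rewrite !(dotvBl, dotvBr, dotvDl, dotvDr) (dotvC w u); lra.
have [c c0 cP] := posdef_coercive Ppos.
have one i : dominated (fun y => c * dotv (y i) (y i)).
  have [j|C C0 sumC] := @dominated_sum 'I_N (index_enum _)
      (fun j y => dotv (y i) (Phi j *m y i)).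
    have [C C0 ij] := pair i j; pose K := \sum_k \sum_l `|Phi j k l|.
    have K0 : 0 <= K by exact: sum_norm_entry_ge0.
    exists (K * C) => [|y y0]; first exact: mulr_ge0.
    have -> : dotv (y i) (Phi j *m y i) =
        dotv (y i - y j) (Phi j *m (y i - y j)).
      rewrite mulmxBr y0 subr0 dotvBl [X in _ - X]dotvC dotv_mull.
      by have [_ ->] := Pproj j; rewrite y0 dotv0 subr0.
    apply: (le_trans (ler_norm _)); apply: (le_trans (dotv_mx_le _ _)).
    by rewrite -mulrA ler_wpM2l// ij.
  exists C => // y y0; apply: (le_trans (cP _)); apply: le_trans (sumC y y0).
  by rewrite mulmx_suml dotv_sumr.
have [C C0 sumC] := @dominated_sum 'I_N (index_enum _) _ one.
(* [C] is only known to be nonnegative, whence the [+ 1] in the denominator. *)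
exists (c / (C + 1)) => [|y y0]; first by rewrite divr_gt0// ltr_wpDl.
have C1 : 0 < C + 1 by lra.
rewrite mulrAC ler_pdivrMr// mulr_sumr (le_trans (sumC y y0))// mulrC.
by rewrite ler_wpM2l ?disagreement_ge0// lerDl.
Qed.

End graph_lemmas.

(** * Uniqueness for linear homogeneous equations *)

Section more_ode.
Variable R : realType.

(** Gronwall's inequality applied to the squared norm; the constant may depend on the final time
    [b], so boundedness of [M] on compact intervals suffices. *)
Lemma ode_vec_zero n (y g : R -> 'cV[R]_n) (M : R -> 'M[R]_n) :
  mxode y g -> (forall t, 0 < t -> g t = M t *m y t) -> y 0 = 0 ->
  (forall b, expO [set t | 0 <= t <= b] 0 M) ->
  forall t, 0 <= t -> y t = 0.
Proof.
move=> yo gE y0 MO b b0; apply: dotvv_eq0; apply/eqP.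
have [C MC] : sexpO [set t | 0 <= t <= b] 0 (fun t => \sum_i \sum_j `|M t i j|).
  apply: sexpO_sum => i; apply: sexpO_sum => j.
  by apply: sexpO_le (MO b i j) => t _; rewrite normr_id.
have Vo := mxodeM (mxode_tr yo) yo.
rewrite eq_le dotvv_ge0 andbT.
suff : dotv (y b) (y b) <= dotv (y 0) (y 0) * expR (2 * C * b).
  by rewrite y0 dotv0 mul0r.
apply: (ode_gronwall (Vo 0 0) b0) => t /andP[t0 tb].
rewrite mxE -/(dotv (y t) (g t)) -/(dotv (g t) (y t)) (dotvC (g t)) gE//.
have := MC t; rewrite /= (ltW t0) (ltW tb) mul0r oppr0 expR0 mulr1 => /(_ isT).
rewrite ger0_norm ?sum_norm_entry_ge0// => MCt.
have : dotv (y t) (M t *m y t) <= C * dotv (y t) (y t).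
  apply: (le_trans (ler_norm _)); apply: (le_trans (dotv_mx_le _ _)).
  by rewrite ler_wpM2r// dotvv_ge0.
by rewrite /dotv; lra.
Qed.

Lemma mxode_zero m n (Y G : R -> 'M[R]_(m, n)) (M : R -> 'M[R]_n) :
  mxode Y G -> (forall t, 0 < t -> G t = Y t *m M t) -> Y 0 = 0 ->
  (forall b, expO [set t | 0 <= t <= b] 0 M) ->
  forall t, 0 <= t -> Y t = 0.
Proof.
move=> Yo GE Y0 MO t t0; apply/matrixP => i j; rewrite mxE.
have yo : mxode (fun t => (row i (Y t))^T) (fun t => (row i (G t))^T).
  by move=> k l; apply: ode_ext (Yo i k) => s; rewrite !mxE.
suff /matrixP/(_ j 0) : (row i (Y t))^T = 0 by rewrite !mxE.
apply: (ode_vec_zero yo (M := fun t => (M t)^T)) t0 => [s s0||b].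
- by rewrite GE// row_mul trmx_mul.
- by rewrite Y0; apply/matrixP => k l; rewrite !mxE.
- exact: expO_tr.
Qed.

Lemma mxode_decay_zero m n (Y G : R -> 'M[R]_(m, n)) (k : R) :
  mxode Y G -> (forall t, 0 < t -> G t = - (k *: Y t)) -> Y 0 = 0 ->
  forall t, 0 <= t -> Y t = 0.
Proof.
move=> Yo GE Y0; apply: (mxode_zero Yo (M := fun=> (- k)%:M)) => //.
  by move=> t t0; rewrite GE// mul_mx_scalar scaleNr.
by move=> b; exact: expO_cst.
Qed.

End more_ode.

(** * Integrals *)

Section integrals.
Variable R : realType.
Notation mu := (@lebesgue_measure R).

Lemma within_integrable (f : R -> R) (a b : R) : 0 <= a ->
  {within `[0, +oo[, continuous f} -> mu.-integrable `[a, b] (EFin \o f).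
Proof.
move=> a0 fc; apply: continuous_compact_integrable; first exact: segment_compact.
apply: continuous_subspaceW fc => x /=.
by rewrite !in_itv/= andbT => /andP[ax _]; rewrite (le_trans a0).
Qed.

Lemma antiderivative (f : R -> R) : {within `[0, +oo[, continuous f} ->
  exists F, ode F f /\ forall a b, 0 <= a -> a <= b ->
    \int[mu]_(x in `[a, b]) f x = F b - F a.
Proof.
move=> fc; pose F (x : R) := \int[mu]_(t in `[0, x]) f t.
have fint a b : 0 <= a -> mu.-integrable `[a, b] (EFin \o f).
  by move=> a0; exact: within_integrable.
have Fd (t : R) : 0 < t -> is_derive t (1 : R) F (f t).
  move=> t0; have tt : t < t + 1 by rewrite ltrDl.
  have [fcont _] := (continuous_within_itvcyP 0 f).1 fc.
  have [] := continuous_FTC1_closed tt (fint 0 (t + 1) (lexx 0)) t0.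
    by apply: fcont; rewrite in_itv/= t0.
  move=> dF F't; apply: DeriveDef; first exact: dF.
  by rewrite -derive1E; exact: F't.
exists F; split; first split=> //.
  apply/continuous_within_itvcyP; split.
    move=> t; rewrite in_itv/= andbT => t0.
    by apply/differentiable_continuous/derivable1_diffP; have [] := Fd t t0.
  (* Continuity at the endpoint 0 concerns a right neighbourhood only, here [[0, 1]]. *)
  have := parameterized_integral_continuous ler01 (fint 0 1 (lexx 0)).
  by move=> /(continuous_within_itvP _ ltr01)[].
move=> a b a0 ab; rewrite /F Rintegral_itvB//; last exact: fint.
apply/esym/Rintegral_itv_obnd_cbnd.
apply: integrableS (fint a b a0) => //.
by apply: subset_itvr; rewrite bnd_simp.
Qed.

Lemma Rintegral_ode (f F : R -> R) (a b : R) : ode F f ->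
  {within `[0, +oo[, continuous f} -> 0 <= a -> a <= b ->
  \int[mu]_(x in `[a, b]) f x = F b - F a.
Proof.
move=> Fo fc a0 ab; have [G [Go ->//]] := antiderivative fc.
have b0 := le_trans a0 ab; have D := odeB Go Fo.
have E t (t0 : 0 <= t) : G t - F t = G 0 - F 0.
  by apply: (ode_eq0_const D t0) => s _; rewrite subrr.
by have := E _ a0; have := E _ b0; lra.
Qed.

Lemma measurable_sampled (g : nat -> R) (delta t : R) : 0 < delta ->
  measurable_fun `[0, t] (fun tau : R => g (Num.truncn (tau / delta))).
Proof.
move=> d0 _ Y mY.
rewrite [X in measurable X](_ : _ = \bigcup_(k in [set k | Y (g k)])
    (`[0, t] `&` `[k%:R * delta, k.+1%:R * delta[)); last first.
  have itvE (x : R) k : 0 <= x -> (k%:R * delta <= x < k.+1%:R * delta) =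
      (Num.truncn (x / delta) == k).
    move=> x0; rewrite -ler_pdivlMr// -ltr_pdivrMr// truncn_eq//.
    by rewrite divr_ge0// ltW.
  apply/seteqP; split=> [x [/= xt Yx]|x [k /= Yk [xt xk]]].
    exists (Num.truncn (x / delta)) => //; split=> //=.
    by move: xt; rewrite !in_itv/= => /andP[x0 _]; rewrite itvE.
  split=> //=; move: xk; rewrite in_itv/= itvE; first by move=> /eqP->.
  by move: xt; rewrite in_itv/= => /andP[].
by apply: bigcup_measurable => k _; apply: measurableI.
Qed.

(** The input equals its limit [c] from time [T + delta] on, so [h], the exponential weight times
    the deviation of the input from [c], lives on a bounded interval. The filter then forgets it at
    the full rate [gamma], without the loss incurred by [sexpO_filter]. *)
Lemma sampled_filter (g : nat -> R) (c B gamma delta T : R) :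
  0 < gamma -> 0 < delta -> (forall k, `|g k| <= B) ->
  (forall k, T <= k%:R * delta -> g k = c) ->
  sexpO (@nonneg_times R) gamma (fun t => gamma * \int[mu]_(tau in `[0, t])
    (expR (- (gamma * (t - tau))) * g (Num.truncn (tau / delta))) - c).
Proof.
move=> g0 d0 gB gc.
(* For [tau < T + delta] one has [expR (gamma * tau) <= expR ((gamma + 1) * (T + delta)) * expR (-
   tau)]. The extra 1 in the exponent yields the majorant [expR (- tau)], valid for all [tau >= 0]
   and with integral at most 1 over every [[0, t]]. *)
pose K := (B + `|c|) * expR ((gamma + 1) * (T + delta)).
have B0 : 0 <= B by exact: le_trans (gB 0%N).
have K0 : 0 <= K by rewrite mulr_ge0 ?expR_ge0// addr_ge0.
exists (gamma * K + `|c|) => t; rewrite /nonneg_times/= => t0.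
pose w (tau : R) := expR (- (gamma * (t - tau))).
have wE tau : w tau = expR (- (gamma * t)) * expR (gamma * tau).
  by rewrite -expRD; congr expR; ring.
have wc : {within `[0, +oo[, continuous w}.
  rewrite (_ : w = fun tau => expR (- (gamma * t)) * expR (gamma * tau)).
    by have [] := odeZ (expR (- (gamma * t))) (ode_expR gamma).
  by apply/funext => tau; exact: wE.
have intw : mu.-integrable `[0, t] (EFin \o w) by exact: within_integrable.
pose G (tau : R) := g (Num.truncn (tau / delta)).
have mG : measurable_fun `[0, t] G by exact: measurable_sampled.
have mw : measurable_fun `[0, t] w.
  by case/integrableP: intw => /measurable_EFinP.
have wpos tau : 0 < w tau by exact: expR_gt0.
have intBw (k : R) : mu.-integrable `[0, t] (EFin \o (fun tau => k * w tau)).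
  apply: within_integrable => //.
  rewrite (_ : (fun tau => _) = fun tau => (k * expR (- (gamma * t))) * expR (gamma * tau)).
    by have [] := odeZ (k * expR (- (gamma * t))) (ode_expR gamma).
  by apply/funext => tau; rewrite wE mulrA.
have intwG : mu.-integrable `[0, t] (EFin \o (fun tau => w tau * G tau)).
  apply: le_integrable (intBw B) => //.
    by apply/measurable_EFinP; exact: measurable_funM.
  move=> tau _; rewrite /= lee_fin !normrM mulrC ler_wpM2r//.
  by rewrite (ger0_norm B0) gB.
have wint : \int[mu]_(tau in `[0, t]) (c * w tau) = c / gamma * (1 - expR (- (gamma * t))).
  rewrite (@Rintegral_ode _ (fun tau => c / gamma * expR (- (gamma * t)) * expR (gamma * tau)))//.
  - have E : expR (- (gamma * t)) * expR (gamma * t) = 1.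
      by rewrite -expRD addNr expR0.
    by rewrite mulr0 expR0 -mulrA E; ring.
  - apply: ode_ext (odeZ _ (ode_expR gamma)) => // tau _.
    by rewrite wE; field; rewrite gt_eqF.
  - rewrite (_ : (fun tau => _) = fun tau => (c * expR (- (gamma * t))) * expR (gamma * tau)).
      by have [] := odeZ (c * expR (- (gamma * t))) (ode_expR gamma).
    by apply/funext => tau; rewrite wE mulrA.
pose h (tau : R) := w tau * G tau - c * w tau.
have intB : \int[mu]_(tau in `[0, t]) h tau =
    \int[mu]_(tau in `[0, t]) (w tau * G tau) - c / gamma * (1 - expR (- (gamma * t))).
  by rewrite RintegralB// ?wint//; exact: intBw.
have inth : mu.-integrable `[0, t] (EFin \o h).
  have m0t : measurable (`[0, t] : set (measurableTypeR R)) by [].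
  by apply: eq_integrable (integrableB m0t intwG (intBw c)).
pose k (tau : R) := K * expR (- (gamma * t)) * expR (-1 * tau).
have kc : {within `[0, +oo[, continuous k}.
  by have [] := odeZ (K * expR (- (gamma * t))) (ode_expR (-1)).
have hk tau : 0 <= tau -> `|h tau| <= k tau.
  move=> tau0; rewrite /h mulrC -mulrBl normrM (gtr0_norm (wpos tau)).
  have [Ttau|tauT] := leP (T + delta) tau.
    have -> : G tau = c.
      (* The last sampling instant before [tau] is later than [tau - delta], hence later than
         [T]. *)
      apply: gc; have := truncnS_gt (tau / delta).
      by rewrite ltr_pdivrMr// -natr1 mulrDl mul1r; lra.
    rewrite subrr normr0 mul0r.
    exact: mulr_ge0 (mulr_ge0 K0 (expR_ge0 _)) (expR_ge0 _).
  rewrite wE /k /K -!mulrA.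
  apply: ler_pM => //.
    by rewrite (le_trans (ler_normB _ _))// lerD2r /G gB.
  rewrite [leRHS]mulrCA ler_pM2l ?expR_gt0// -expRD ler_expR; nra.
have intk : mu.-integrable `[0, t] (EFin \o k) by exact: within_integrable.
have kint : \int[mu]_(tau in `[0, t]) k tau <= K * expR (- (gamma * t)).
  rewrite (@Rintegral_ode _ (fun tau => - (K * expR (- (gamma * t))) * expR (-1 * tau)))//.
    rewrite mulr0 expR0 !mulNr mulr1 opprK addrC lerBlDr lerDl.
    exact: mulr_ge0 (mulr_ge0 K0 (expR_ge0 _)) (expR_ge0 _).
  by apply: ode_ext (odeZ _ (ode_expR (-1))) => // tau _; rewrite /k; ring.
have hint : `|\int[mu]_(tau in `[0, t]) h tau| <= K * expR (- (gamma * t)).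
  apply: (le_trans (le_normr_Rintegral _ inth)) => //; apply: le_trans kint.
  apply: le_Rintegral => //.
    exact: integrable_norm inth.
  by move=> tau; rewrite /= in_itv/= => /andP[/hk].
rewrite -/G [X in `|_ * X - _|](_ : _ = \int[mu]_(tau in `[0, t]) h tau +
   c / gamma * (1 - expR (- (gamma * t)))); last by rewrite intB subrK.
rewrite [X in `|X|](_ : _ = gamma * \int[mu]_(tau in `[0, t]) h tau -
  c * expR (- (gamma * t))); last by field; rewrite gt_eqF.
rewrite (le_trans (ler_normB _ _))// mulrDl lerD//.
  by rewrite normrM (gtr0_norm g0) -mulrA ler_pM2l.
by rewrite normrM (gtr0_norm (expR_gt0 _)).
Qed.

End integrals.

(** * Excitation of a single node *)

Section node_excitation.
Variable R : realType.
Notation mu := (@lebesgue_measure R).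
Local Notation cont f := {within `[(0 : R), +oo[, continuous (f : R -> R)}.

Lemma contD (f g : R -> R) : cont f -> cont g -> cont (fun t => f t + g t).
Proof. by move=> fc gc x; apply: continuousD; [exact: fc|exact: gc]. Qed.

Lemma contM (f g : R -> R) : cont f -> cont g -> cont (fun t => f t * g t).
Proof. by move=> fc gc x; apply: continuousM; [exact: fc|exact: gc]. Qed.

Lemma cont_cst (c : R) : cont (fun=> c).
Proof. by have [] := ode_cst c. Qed.

Lemma cont_sum (I : Type) (r : seq I) (F : I -> R -> R) :
  (forall i, cont (F i)) -> cont (fun t => \sum_(i <- r) F i t).
Proof.
move=> Fc; elim: r => [|i r IH].
  rewrite (_ : (fun t => _) = fun=> 0); first exact: cont_cst.
  by apply/funext => t; rewrite big_nil.
rewrite (_ : (fun t => _) = fun t => F i t + \sum_(j <- r) F j t).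
  exact: contD.
by apply/funext => t; rewrite big_cons.
Qed.

Lemma mx_antiderivative m n (X : R -> 'M[R]_(m, n)) :
  (forall i j, cont (fun t => X t i j)) ->
  exists F, mxode F X /\ forall a b, 0 <= a -> a <= b ->
    mxintegral `[a, b] X = F b - F a.
Proof.
move=> Xc.
have /choice[F FP] : forall ij : 'I_m * 'I_n, exists f : R -> R,
    ode f (fun t => X t ij.1 ij.2) /\ forall a b, 0 <= a -> a <= b ->
    \int[mu]_(x in `[a, b]) X x ij.1 ij.2 = f b - f a.
  by move=> ij; exact: antiderivative.
exists (fun t => \matrix_(i, j) F (i, j) t); split=> [i j|a b a0 ab].
  by apply: ode_ext (FP (i, j)).1 => t; rewrite ?mxE.
by apply/matrixP => i j; rewrite !mxE (FP (i, j)).2.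
Qed.

Lemma ode_dotv n (X F : R -> 'M[R]_n) (u v : 'cV[R]_n) : mxode X F ->
  ode (fun t => dotv u (X t *m v)) (fun t => dotv u (F t *m v)).
Proof. by move=> Xo; exact: (mxodeMl u^T (mxodeMr v Xo)) 0 0. Qed.

Lemma ode_dotvr n (x f : R -> 'cV[R]_n) (u : 'cV[R]_n) : mxode x f ->
  ode (fun t => dotv u (x t)) (fun t => dotv u (f t)).
Proof. by move=> xo; exact: (mxodeMl u^T xo) 0 0. Qed.

Lemma dotv_outer n (u v : 'cV[R]_n) : dotv u (v *m v^T *m u) = dotv v u ^+ 2.
Proof.
rewrite /dotv -mulmxA mulmxA mxE big_ord1 expr2; congr (_ * _).
by rewrite -/(dotv u v) dotvC.
Qed.

(** A step from [w] along the residual [r], of length factor [h = dotv r r / K] with [K] above the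
    curvature in that direction, would lower the cost by at least [h * dotv r r / 2]. *)
Lemma quadratic_minimizer n (M : 'M[R]_n) (b w : 'cV[R]_n) : M^T = M ->
  (forall v, - dotv w b + 1 / 2 * dotv w (M *m w) <=
             - dotv v b + 1 / 2 * dotv v (M *m v)) -> M *m w = b.
Proof.
move=> Msym wmin; pose r := b - M *m w.
suff : r = 0 by move/eqP; rewrite subr_eq0 => /eqP.
have rE : dotv r (M *m w) = dotv r b - dotv r r.
  by rewrite -dotvBr /r opprB addrCA subrr addr0.
clearbody r; apply: dotvv_eq0; apply/eqP; rewrite eq_le dotvv_ge0 andbT leNgt.
apply/negP => r0; have [K K0 xK] : exists2 K : R, 0 < K & dotv r (M *m r) <= K.
  exists (`|dotv r (M *m r)| + 1); first by rewrite ltr_wpDl.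
  by rewrite (le_trans (ler_norm _))// lerDl.
have [h h0 hK] : exists2 h : R, 0 < h & h * K = dotv r r.
  by exists (dotv r r / K); [rewrite divr_gt0|rewrite divfK// gt_eqF].
have := wmin (w + h *: r).
rewrite mulmxDr -scalemxAr !(dotvDl, dotvDr, dotvZl, dotvZr).
have -> : dotv w (M *m r) = dotv r (M *m w) by rewrite dotvC dotv_mull Msym.
have hx : h * h * dotv r (M *m r) <= h * h * K by rewrite ler_pM2l// mulr_gt0.
have := mulr_gt0 (mulr_gt0 h0 h0) K0.
by rewrite rE -hK; lra.
Qed.

Variables (n q : nat) (T alpha beta : R) (Phi : 'M[R]_n).
Variables (phi : R -> 'cV[R]_n) (z : R -> R) (theta0 : 'cV[R]_n).
Hypotheses (T0 : 0 < T) (alpha0 : 0 < alpha) (beta0 : 0 < beta).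
Hypothesis phic : forall i, cont (fun t => phi t i 0).
Hypothesis phi_ppe : ppe T phi q Phi.

Let Phi_proj : orthogonal_projection Phi. Proof. by have [] := phi_ppe. Qed.

Lemma gramian_cont i j : cont (fun t => (phi t *m (phi t)^T) i j).
Proof.
rewrite (_ : (fun t => _) = fun t => phi t i 0 * phi t j 0).
  by apply: contM; exact: phic.
by apply/funext => t; rewrite mxE big_ord1 !mxE.
Qed.

(** For [x] in the kernel of [Phi], the upper excitation bound forces the integral of the squared
    product of [phi] with [x] over a window to be at most 0. Its nondecreasing antiderivative is
    then constant on the window, and the integrand, being the derivative, vanishes at [t]. *)
Lemma ppe_proj t : 0 < t -> Phi *m phi t = phi t.
Proof.
move=> t0; have [PP Psym] := Phi_proj.
suff E x : Phi *m x = 0 -> dotv (phi t) x = 0.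
  apply/esym/eqP; rewrite -subr_eq0; apply/eqP; apply: dotvv_eq0.
  rewrite {1}(_ : phi t - Phi *m phi t = (1%:M - Phi) *m phi t); last first.
    by rewrite mulmxBl mul1mx.
  have [_ Csym] := orthogonal_projectionC Phi_proj.
  by rewrite dotv_mull Csym E// mulmxA [Phi *m (1%:M - _)]mulmxBr mulmx1 PP subrr mul0mx.
move=> Px.
have [F [Fo FI]] := mx_antiderivative gramian_cont.
have fo := ode_dotv x x Fo.
(* The window starts at a nonnegative time and has [t] in its interior, as the two-sided derivative
   requires. *)
pose a := Num.max 0 (t - T / 2).
have a0 : 0 <= a by rewrite le_max lexx.
have at_ : a < t by rewrite gt_max t0/= ltrBlDr ltrDl divr_gt0.
have tb : t < a + T.
  have : t - T / 2 <= a by rewrite le_max lexx orbT.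
  by lra.
have [_ _ _ [ka [kb [_ _ /(_ a a0)[_ [_ /(_ x)]]]]]] := phi_ppe.
rewrite FI//; last by rewrite lerDl ltW.
rewrite mulmxBl -scalemxAl Px scaler0 sub0r mulmxBl dotvNr dotvBr oppr_ge0.
rewrite subr_le0 => FT.
have mono c d : 0 <= c -> c <= d -> dotv x (F c *m x) <= dotv x (F d *m x).
  by move=> c0 cd; apply: (ode_ge fo c0 cd) => s _; rewrite dotv_outer sqr_ge0.
have Fcst s : a < s < a + T -> dotv x (F s *m x) = dotv x (F a *m x).
  move=> /andP[as_ sT]; apply/eqP; rewrite eq_le (mono a s) ?andbT ?(ltW as_)//.
  by apply: (le_trans _ FT); apply: mono; [exact: le_trans (ltW as_)|exact: ltW].
have [_ Fd] := fo.2 t t0.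
have : is_derive t (1 : R) (fun t => dotv x (F t *m x)) 0.
  apply: near_eq_is_derive (is_derive_cst (dotv x (F a *m x)) t 1).
  near=> s; apply/esym/Fcst; apply/andP; split; near: s.
    exact: lt_nbhsr.
  exact: lt_nbhsl.
move=> [_]; rewrite Fd dotv_outer => /eqP.
by rewrite sqrf_eq0 => /eqP.
Unshelve. all: by end_near. Qed.

Variables (Q : R -> 'M[R]_n) (varphi : R -> 'cV[R]_n).
Hypothesis Q0 : Q 0 = 0.
Hypothesis Qo : mxode Q (fun t => - (beta *: Q t) + phi t *m (phi t)^T).

Lemma gramian_sym t : 0 <= t -> (Q t)^T = Q t.
Proof.
move=> t0; apply/eqP; rewrite -subr_eq0; apply/eqP.
apply: (mxode_decay_zero (mxodeB (mxode_tr Qo) Qo) (k := beta)) t0 => [s _|].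
  rewrite linearD/= linearN/= linearZ/= trmx_mul trmxK opprD addrACA subrr addr0.
  by rewrite scalerBr opprB addrC opprK.
by rewrite Q0 trmx0 subrr.
Qed.

Lemma gramian_projr t : 0 <= t -> Q t *m Phi = Q t.
Proof.
have [PP Psym] := Phi_proj.
move=> t0; apply/eqP; rewrite -subr_eq0; apply/eqP.
apply: (mxode_decay_zero (mxodeB (mxodeMr Phi Qo) Qo) (k := beta)) t0 => [s s0|].
  rewrite mulmxDl mulNmx -mulmxA -{2}Psym -trmx_mul ppe_proj// -scalemxAl.
  by rewrite opprD addrACA subrr addr0 scalerBr opprB addrC opprK.
by rewrite Q0 mul0mx subrr.
Qed.

Lemma gramian_projl t : 0 <= t -> Phi *m Q t = Q t.
Proof.
move=> t0; have [_ Psym] := Phi_proj.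
by apply: trmx_inj; rewrite trmx_mul Psym gramian_sym// gramian_projr.
Qed.

(** [expR (beta * t) *: Q t] is the integral of the weighted outer products of the regressor, hence
    nondecreasing in the semidefinite order. *)
Lemma gramian_mono x a b : 0 <= a -> a <= b ->
  expR (beta * a) * dotv x (Q a *m x) <= expR (beta * b) * dotv x (Q b *m x).
Proof.
move=> a0 ab; apply: (ode_ge (ode_expM beta (ode_dotv x x Qo)) a0 ab) => t _.
rewrite mulmxDl dotvDr mulNmx dotvNr -scalemxAl dotvZr addrA subrr add0r.
by rewrite dotv_outer mulr_ge0 ?expR_ge0 ?sqr_ge0.
Qed.

Lemma gramian_ge0 x t : 0 <= t -> 0 <= dotv x (Q t *m x).
Proof.
move=> t0; have := gramian_mono x (lexx 0) t0.
by rewrite Q0 mul0mx dotv0 mulr0 pmulr_rge0// expR_gt0.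
Qed.

Lemma gramian_lower : exists2 k, 0 < k & forall x t, T <= t ->
  k * dotv x (Phi *m x) <= dotv x (Q t *m x).
Proof.
have [_ _ _ [ka [kb [ka0 _ PE]]]] := phi_ppe.
exists (ka * expR (- (beta * T))) => [|x t Tt]; first by rewrite mulr_gt0 ?expR_gt0.
have a0 : 0 <= t - T by rewrite subr_ge0.
have [F [Fo FI]] := mx_antiderivative gramian_cont.
have := PE _ a0; rewrite FI//=; last by rewrite lerDl ltW.
rewrite subrK => -[[_ /(_ x) FT] _]; move: FT.
rewrite 2!mulmxBl -scalemxAl !dotvBr dotvZr subr_ge0 => FT.
pose c := expR (beta * (t - T)).
have c0 : 0 < c by exact: expR_gt0.
have Tt' : t - T <= t by rewrite lerBlDr lerDl ltW.
have := ode_ge (odeB (ode_expM beta (ode_dotv x x Qo)) (odeZ c (ode_dotv x x Fo))) a0 Tt'.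
move=> H; have {}H : c * dotv x (Q (t - T) *m x) - c * dotv x (F (t - T) *m x) <=
    expR (beta * t) * dotv x (Q t *m x) - c * dotv x (F t *m x).
  apply: H => s /andP[s1 s2].
  rewrite mulmxDl dotvDr mulNmx dotvNr -scalemxAl dotvZr [beta * _ + _]addrA.
  rewrite subrr add0r -mulrBl dotv_outer mulr_ge0 ?sqr_ge0// subr_ge0 ler_expR.
  by rewrite ler_pM2l// ltW.
have cE : c = expR (beta * t) * expR (- (beta * T)).
  by rewrite -expRD; congr expR; ring.
have : 0 <= c * dotv x (Q (t - T) *m x) by rewrite mulr_ge0 ?gramian_ge0// ltW.
rewrite -(ler_pM2l (expR_gt0 (beta * t))) => Qge.
have : c * (ka * dotv x (Phi *m x)) <=
    c * (dotv x (F t *m x) - dotv x (F (t - T) *m x)) by rewrite ler_pM2l.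
by rewrite [X in X * (ka * _)]cE; lra.
Qed.

Lemma gramian_ker (x : 'cV[R]_n) t : T <= t -> Q t *m x = 0 -> Phi *m x = 0.
Proof.
move=> Tt Qx; have [PP Psym] := Phi_proj; have [k k0 /(_ x t Tt)] := gramian_lower.
rewrite Qx dotv0 pmulr_rle0// => Px; apply: dotvv_eq0; apply/eqP.
by rewrite eq_le dotvv_ge0 andbT dotv_mull Psym mulmxA PP.
Qed.

(** After [T] excitation gives the bound; before [T], the regularization has not yet decayed below
    [alpha * expR (- (beta * T))]. *)
Lemma regularized_coercive : exists2 c, 0 < c & forall x t, 0 <= t ->
  c * dotv x (Phi *m x) <=
    dotv x (Q t *m x) + alpha * expR (- (beta * t)) * dotv x (Phi *m x).
Proof.
have [k k0 kP] := gramian_lower.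
have [PP Psym] := Phi_proj.
have aT : 0 < alpha * expR (- (beta * T)) by rewrite mulr_gt0 ?expR_gt0.
exists (Num.min k (alpha * expR (- (beta * T)))) => [|x t t0]; first by rewrite lt_min k0.
have Px : 0 <= dotv x (Phi *m x).
  by rewrite -PP -mulmxA -{1}Psym -dotv_mull dotvv_ge0.
have at0 : 0 <= alpha * expR (- (beta * t)) by rewrite mulr_ge0 ?expR_ge0 ?ltW.
have [Tt|tT] := leP T t.
  rewrite (@le_trans _ _ (k * dotv x (Phi *m x)))//.
    by rewrite ler_wpM2r// ge_min lexx.
  by rewrite (le_trans (kP x t Tt))// lerDl mulr_ge0.
rewrite (@le_trans _ _ (alpha * expR (- (beta * t)) * dotv x (Phi *m x)))//.
  rewrite ler_wpM2r// ge_min; apply/orP; right.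
  by rewrite ler_pM2l// ler_expR lerN2 ler_pM2l// ltW.
by rewrite lerDr gramian_ge0.
Qed.

Hypothesis zc : cont z.
Hypothesis v0 : varphi 0 = alpha *: theta0.
Hypothesis vo : mxode varphi (fun t => - (beta *: varphi t) + z t *: phi t).

(** Completing the weights [expR (beta * tau)] turns the filters [varphi] and [Q] into
    antiderivatives of the linear and quadratic parts of the cost; [W] is their combination. The
    initial value [alpha *: theta0] of [varphi] cancels the linear term of the regularization. *)
Lemma ls_costE t : 0 <= t -> exists c, forall v,
  ls_cost alpha beta theta0 phi z t v = c + (- dotv v (varphi t) +
    1 / 2 * dotv v ((Q t + (alpha * expR (- (beta * t)))%:M) *m v)).
Proof.
move=> t0.
have [A [Ao _]] := antiderivative (contM (proj1 (ode_expR beta)) (contM zc zc)).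
pose e := expR (- (beta * t)).
exists (1 / 2 * e * (A t - A 0) + alpha / 2 * e * dotv theta0 theta0) => v.
pose W (tau : R) := A tau + - 2 * (expR (beta * tau) * dotv v (varphi tau)) +
  expR (beta * tau) * dotv v (Q tau *m v).
have Wo : ode W (fun tau => expR (beta * tau) * (z tau - dotv v (phi tau)) ^+ 2).
  apply: ode_ext (odeD (odeD Ao (odeZ (-2) (ode_expM beta (ode_dotvr v vo))))
    (ode_expM beta (ode_dotv v v Qo))) => // s _.
  rewrite mulmxDl !dotvDr mulNmx !dotvNr -scalemxAl !dotvZr dotv_outer (dotvC (phi s)).
  by ring.
have phidc : cont (fun s => dotv v (phi s)).
  rewrite (_ : (fun s => _) = fun s => \sum_i v i 0 * phi s i 0).
    by apply: cont_sum => i; apply: contM; [exact: cont_cst|exact: phic].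
  by apply/funext => s; rewrite dotvE.
have dc : cont (fun s => z s + - 1 * dotv v (phi s)).
  by apply: contD => //; apply: contM => //; exact: cont_cst.
have fc : cont (fun tau => expR (- (beta * (t - tau))) *
    (z tau - dotv v (phi tau)) ^+ 2).
  rewrite (_ : (fun tau => _) = fun tau => (e * expR (beta * tau)) *
    ((z tau + - 1 * dotv v (phi tau)) * (z tau + - 1 * dotv v (phi tau)))).
    apply: contM; last exact: contM.
    by apply: contM; [exact: cont_cst|exact: (ode_expR beta).1].
  apply/funext => tau; rewrite mulN1r -expr2 /e -expRD.
  by congr (expR _ * _); ring.
have eWo : ode (fun tau => e * W tau) (fun tau => expR (- (beta * (t - tau))) *
    (z tau - dotv v (phi tau)) ^+ 2).
  apply: ode_ext (odeZ e Wo) => [s|s _]; first by [].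
  by rewrite mulrA /e -expRD; congr (expR _ * _); ring.
rewrite /ls_cost (Rintegral_ode eWo fc (lexx 0) t0).
have -> : enorm (v - theta0) ^+ 2 =
    dotv v v - 2 * dotv v theta0 + dotv theta0 theta0.
  rewrite /enorm sqr_sqrtr; last by rewrite sumr_ge0// => i; rewrite sqr_ge0.
  transitivity (dotv (v - theta0) (v - theta0)); first by rewrite dotvE.
  by rewrite dotvBl !dotvBr (dotvC theta0 v); ring.
have eE : e * expR (beta * t) = 1 by rewrite /e -expRD addNr expR0.
rewrite -/e /W v0 Q0 mulr0 expR0 mul0mx dotv0 mulmxDl dotvDr mul_scalar_mx !dotvZr.
have -> : e * (A t + - 2 * (expR (beta * t) * dotv v (varphi t)) +
   expR (beta * t) * dotv v (Q t *m v)) = e * A t - 2 * dotv v (varphi t) + dotv v (Q t *m v).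
  rewrite !mulrDr [e * (_ * (_ * _))]mulrCA !mulrA -[_ * e * _]mulrA eE.
  by rewrite -!mulrA; ring.
by field.
Qed.

Lemma ls_normal_equation thstar t : 0 <= t ->
  ls_solution alpha beta theta0 phi z thstar ->
  Q t *m thstar t + (alpha * expR (- (beta * t))) *: thstar t = varphi t.
Proof.
move=> t0 ls; have [c cE] := ls_costE t0.
rewrite -mul_scalar_mx -mulmxDl; apply: quadratic_minimizer.
  by rewrite linearD/= tr_scalar_mx gramian_sym.
by move=> v; have := ls t t0 v; rewrite !cE lerD2l.
Qed.

Lemma noise_free_varphi theta : (forall t, 0 <= t -> z t = dotv (phi t) theta) ->
  forall t, 0 <= t ->
  varphi t = Q t *m theta + (alpha * expR (- (beta * t))) *: theta0.
Proof.
move=> zE t t0; apply/eqP; rewrite -subr_eq0; apply/eqP.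
have eo := mxodeZ (odeZ alpha (ode_expRN beta)) (mxode_cst theta0).
apply: (mxode_decay_zero (mxodeB vo (mxodeD (mxodeMr theta Qo) eo)) (k := beta)) t0.
  move=> s s0; rewrite zE ?ltW// mulmxDl -mulmxA mulNmx -scalemxAl scaler0 addr0.
  have -> : dotv (phi s) theta *: phi s = phi s *m ((phi s)^T *m theta).
    rewrite [(phi s)^T *m theta]mx11_scalar mul_mx_scalar.
    by rewrite /dotv.
  move: (phi s *m _) (Q s *m theta) (varphi s) => x y w.
  by apply/matrixP => i j; rewrite !mxE; ring.
by rewrite v0 Q0 mul0mx add0r mulr0 oppr0 expR0 mulr1 subrr.
Qed.

End node_excitation.

(** * The local estimator *)

Section node_convergence.
Variable R : realType.
Local Notation nn := (@nonneg_times R).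
Variables (n q : nat) (T alpha beta gamma kappa : R) (Phi : 'M[R]_n).
Variables (phi : R -> 'cV[R]_n) (z : R -> R) (theta0 : 'cV[R]_n).
Variables (thstar : R -> 'cV[R]_n).
Hypotheses (T0 : 0 < T) (alpha0 : 0 < alpha) (beta0 : 0 < beta).
Hypotheses (gamma0 : 0 < gamma) (kappa0 : 0 < kappa).
Hypothesis phic : forall i, {within `[0, +oo[, continuous (fun t => phi t i 0)}.
Hypothesis zc : {within `[0, +oo[, continuous z}.
Hypothesis phiO : expO nn 0 phi.
Hypothesis zO : sexpO nn 0 z.
Hypothesis phi_ppe : ppe T phi q Phi.
Hypothesis ls : ls_solution alpha beta theta0 phi z thstar.

Variables (Q P P' Omega : R -> 'M[R]_n) (varphi thd : R -> 'cV[R]_n).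
Hypotheses (Q0 : Q 0 = 0) (P0 : P 0 = 0) (Omega0 : Omega 0 = kappa^-1 *: 1%:M).
Hypotheses (varphi0 : varphi 0 = alpha *: theta0) (thd0 : thd 0 = 0).
Hypothesis Qo : mxode Q (fun t => - (beta *: Q t) + phi t *m (phi t)^T).
Hypothesis Po : mxode P P'.
Hypothesis P'E : expO nn gamma (fun t => P' t + gamma *: (P t - Phi)).
Hypothesis vo : mxode varphi (fun t => - (beta *: varphi t) + z t *: phi t).
Let Rm t := P t *m phi t *m (phi t)^T *m P t + (kappa * beta) *: (1%:M - P t)
  + P' t *m Q t *m P t + P t *m Q t *m P' t
  + (alpha * expR (- (beta * t)) - kappa) *: P' t.
Hypothesis Oo : mxode Omega
  (fun t => beta *: Omega t - Omega t *m Rm t *m Omega t).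
Hypothesis thdo : mxode thd (fun t => - (Omega t *m
  (Rm t *m thd t - z t *: (P t *m phi t) - P' t *m varphi t))).

Let Phi_proj : orthogonal_projection Phi. Proof. by have [] := phi_ppe. Qed.
Let nn0 : forall t : R, nn t -> 0 <= t. Proof. by []. Qed.
Let e t := alpha * expR (- (beta * t)).

Let eO : sexpO nn beta e.
Proof. by apply: sexpOMr; [exact: sexpO_cst|exact: sexpO_expR]. Qed.

Let eO0 : sexpO nn 0 e. Proof. by apply: sexpO_weak eO => //; exact: ltW. Qed.

Let QO : expO nn 0 Q.
Proof.
apply: (expO_filter Qo beta0); apply: expO_ext (expOMl phiO (expO_tr phiO)).
by move=> t _; rewrite addrAC addNr add0r.
Qed.

Let varphiO : expO nn 0 varphi.
Proof.
apply: (expO_filter vo beta0); apply: expO_ext (expOZr zO phiO).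
by move=> t _; rewrite addrAC addNr add0r.
Qed.

Lemma filtered_projection sigma : sigma < gamma ->
  expO nn sigma (fun t => P t - Phi).
Proof.
move=> sg; apply: (expO_filter (mxodeB Po (mxode_cst Phi)) sg).
apply: expO_ext (expO_weak nn0 (ltW sg) P'E).
by move=> t _; rewrite subr0.
Qed.

Lemma filtered_projection_bounded : expO nn 0 P.
Proof.
apply: expO_ext (expOD (filtered_projection gamma0) (expO_cst nn Phi)).
by move=> t _; rewrite subrK.
Qed.
Let PO := filtered_projection_bounded.

Let P'O : expO nn 0 P'.
Proof.
apply: expO_ext (expOB (expO_weak nn0 (ltW gamma0) P'E)
  (expOZr (sexpO_cst nn gamma) (filtered_projection gamma0))).
by move=> t _; rewrite addrK.
Qed.

Let PphiO : expO nn 0 (fun t => P t *m phi t). Proof. exact: expOMl. Qed.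

Let RmO : expO nn 0 Rm.
Proof.
apply: expOD; last first.
  apply: expOZr => //; apply: sexpOD => //; exact: sexpO_cst.
apply: expOD; last by do 2 ! apply: expOMl => //.
apply: expOD; last by do 2 ! apply: expOMl => //.
apply: expOD; last first.
  apply: expOZr; first exact: sexpO_cst.
  by apply: expOB => //; exact: expO_cst.
by do 2 ! apply: expOMl => //; exact: expO_tr.
Qed.

Let S t := P t *m Q t *m P t + e t *: P t + kappa *: (1%:M - P t).

(** This identity explains the form of [Rm]: it is the derivative of [S] plus [beta *: S t], so that
    the equation of [Omega] is that of an inverse of [S]. *)
Let S_ode : mxode S (fun t => Rm t - beta *: S t).
Proof.
have eo : ode e (fun t => - (beta * e t)).
  by apply: ode_ext (odeZ alpha (ode_expRN beta)) => // t _; rewrite /e; ring.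
apply: mxode_ext (mxodeD (mxodeD (mxodeM (mxodeM Po Qo) Po) (mxodeZ eo Po))
  (mxodeZ (ode_cst kappa) (mxodeB (mxode_cst 1%:M) Po))) => // t _.
rewrite /Rm /S -/(e t) !(mulmxDl, mulmxDr) !(mulmxN, mulNmx) -!scalemxAr -!scalemxAl !mulmxA.
rewrite scale0r add0r sub0r.
move: (P' t *m Q t *m P t) (P t *m Q t *m P' t) (P t *m Q t *m P t)
  (P t *m phi t *m (phi t)^T *m P t) => A B C D.
by apply/matrixP => i j; rewrite !mxE; ring.
Qed.

(** The defect [Y = S Omega - 1] satisfies [Y' = - Y Rm Omega] and vanishes at 0. Invertibility of
    [S] is a consequence, and [Omega] is bounded on compact intervals simply by continuity. *)
Let S_Omega t : 0 <= t -> S t *m Omega t = 1%:M.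
Proof.
move=> t0; apply/eqP; rewrite -subr_eq0; apply/eqP.
apply: (mxode_zero (mxodeB (mxodeM S_ode Oo) (mxode_cst 1%:M))
  (M := fun t => - (Rm t *m Omega t))) t0 => [s _||b].
- rewrite subr0 mulmxBl mulmxBr mulmxN mulmxBl mul1mx -scalemxAl -scalemxAr !mulmxA.
  move: (Rm s *m Omega s) (S s *m Omega s *m Rm s *m Omega s) (S s *m Omega s).
  by move=> A B C; apply/matrixP => i j; rewrite !mxE; ring.
- by rewrite /S P0 !mul0mx scaler0 !add0r subr0 Omega0 -scalemxAr mulmx1 scalerA
    mulVf ?gt_eqF// scale1r subrr.
- apply: expON; apply: expOMl; last by move=> i j; exact: sexpO_ode (Oo i j).
  by apply: expO_sub RmO => s /= /andP[].
Qed.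

Let S_thd t : 0 <= t -> S t *m thd t = P t *m varphi t.
Proof.
move=> t0; apply/eqP; rewrite -subr_eq0; apply/eqP.
apply: (mxode_decay_zero (mxodeB (mxodeM S_ode thdo) (mxodeM Po vo)) (k := beta)) t0.
  move=> s s0; rewrite mulmxN mulmxA S_Omega ?ltW// mul1mx mulmxBl mulmxDr mulmxN.
  rewrite -!scalemxAr -scalemxAl.
  move: (Rm s *m thd s) (S s *m thd s) (P s *m varphi s) (P' s *m varphi s)
    (P s *m phi s) => a1 a2 a3 a4 a5.
  by apply/matrixP => i j; rewrite !mxE; ring.
by rewrite thd0 P0 mulmx0 mul0mx subrr.
Qed.

Let normal t : 0 <= t ->
  Q t *m thstar t + e t *: thstar t = varphi t.
Proof.
by move=> t0; exact: (ls_normal_equation phic Q0 Qo zc varphi0 vo t0 ls).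
Qed.

Let Q_Phir t : 0 <= t -> Q t *m Phi = Q t.
Proof. by move=> t0; exact: (gramian_projr T0 phic phi_ppe Q0 Qo). Qed.

Let Q_Phil t : 0 <= t -> Phi *m Q t = Q t.
Proof. by move=> t0; exact: (gramian_projl T0 phic phi_ppe Q0 Qo). Qed.

Let PhiK (m : nat) (x : 'M[R]_(n, m)) : Phi *m (Phi *m x) = Phi *m x.
Proof. by have [PP _] := Phi_proj; rewrite mulmxA PP. Qed.

(** The equation is tested with [Phi *m x t], where [Q] absorbs [Phi] on both sides. Only this
    component is bounded uniformly in time: on the kernel of [Phi] the coefficient is [e t], which
    tends to 0. *)
Lemma projected_coercive rho (x g : R -> 'cV[R]_n) :
  (forall t, 0 <= t -> Q t *m x t + e t *: x t = g t) ->
  expO nn rho g -> expO nn rho (fun t => Phi *m x t).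
Proof.
move=> xE gO; have [c c0 cP] := regularized_coercive T0 alpha0 beta0 phic phi_ppe Q0 Qo.
apply: (expO_coercive c0 (g := fun t => Phi *m g t)).
  move=> t t0; have := cP (Phi *m x t) t t0.
  rewrite -xE// mulmxDr -scalemxAr !mulmxA Q_Phil// Q_Phir//.
  by have [-> _] := Phi_proj; rewrite dotvDr dotvZr.
exact: (expOMr (expO_cst nn Phi)).
Qed.

Lemma local_ls_bounded : expO nn 0 (fun t => Phi *m thstar t).
Proof. exact: projected_coercive normal varphiO. Qed.

(** Without noise the normal equation for [thstar t - theta] has right-hand side
    [e t *: (theta0 - theta)], which decays at rate [beta]. *)
Lemma noise_free_local_ls theta : (forall t, 0 <= t -> z t = dotv (phi t) theta) ->
  expO nn beta (fun t => Phi *m (thstar t - theta)).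
Proof.
move=> zE; apply: (projected_coercive (g := fun t => e t *: (theta0 - theta))).
  move=> t t0; have := normal t0.
  rewrite (noise_free_varphi Q0 Qo varphi0 vo zE t0) -/(e t) => H.
  rewrite mulmxBr !scalerBr; move: H.
  move: (Q t *m thstar t) (Q t *m theta) (e t *: thstar t) => a b c H.
  have -> : a = b + e t *: theta0 - c by rewrite -H addrK.
  by apply/matrixP => i j; rewrite !mxE; ring.
exact: (expOZl eO (expO_cst nn _)).
Qed.

Let Sbar t := Q t + e t *: Phi + kappa *: (1%:M - Phi).

Let Sbar_coercive : exists2 c, 0 < c & forall t w, 0 <= t ->
  c * dotv w w <= dotv w (Sbar t *m w).
Proof.
have [c c0 cP] := regularized_coercive T0 alpha0 beta0 phic phi_ppe Q0 Qo.
exists (Num.min c kappa) => [|t w t0]; first by rewrite lt_min c0.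
have [PP Psym] := Phi_proj; have [CC Csym] := orthogonal_projectionC Phi_proj.
have pos1 : 0 <= dotv w (Phi *m w).
  by rewrite -PP -mulmxA -{1}Psym -dotv_mull dotvv_ge0.
have pos2 : 0 <= dotv w ((1%:M - Phi) *m w).
  by rewrite -CC -mulmxA -{1}Csym -dotv_mull dotvv_ge0.
have split : dotv w w = dotv w (Phi *m w) + dotv w ((1%:M - Phi) *m w).
  by rewrite -dotvDr -mulmxDl addrC subrK mul1mx.
rewrite !mulmxDl -!scalemxAl !dotvDr !dotvZr split.
have := cP w t t0; rewrite -/(e t).
have m1 : Num.min c kappa * dotv w (Phi *m w) <= c * dotv w (Phi *m w).
  by rewrite ler_wpM2r// ge_min lexx.
have m2 : Num.min c kappa * dotv w ((1%:M - Phi) *m w) <= kappa * dotv w ((1%:M - Phi) *m w).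
  by rewrite ler_wpM2r// ge_min lexx orbT.
lra.
Qed.

Let S_Sbar sigma : 0 <= sigma -> sigma < gamma ->
  expO nn sigma (fun t => S t - Sbar t).
Proof.
move=> s0 sg; have PPO := filtered_projection sg.
apply: (@expO_ext _ _ _ _ _ (fun t => (P t - Phi) *m Q t *m P t +
    Phi *m Q t *m (P t - Phi) + (e t - kappa) *: (P t - Phi))).
  move=> t t0; rewrite mulmxBr !mulmxBl !Q_Phil// Q_Phir// /S /Sbar !scalerBr !scalerBl.
  move: (P t *m Q t *m P t) (Q t *m P t) => A B.
  by apply/matrixP => i j; rewrite !mxE; ring.
apply: expOD; first apply: expOD.
- by do 2 ! apply: expOMl => //.
- by apply: expOMr => //; apply: expOMl => //; exact: expO_cst.
- apply: expOZr => //; apply: sexpOD => //; exact: sexpO_cst.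
Qed.

(** The error [w] solves [S w = g] with [g] of rate [sigma], since [Phi *m varphi t] equals [Sbar t]
    applied to [Phi *m thstar t]. Coercivity of [S] is borrowed from [Sbar] once the two are closer
    than half the constant [c]; before that time [w] is merely bounded. *)
Let thd_error sigma : 0 < sigma -> sigma < gamma ->
  expO nn sigma (fun t => thd t - Phi *m thstar t).
Proof.
move=> s0 sg; have DO := S_Sbar (ltW s0) sg.
set w := fun t => _; have [c c0 cP] := Sbar_coercive.
pose g t := (P t - Phi) *m varphi t - (S t - Sbar t) *m (Phi *m thstar t).
have gO : expO nn sigma g.
  apply: expOB; apply: expOMl => //; first exact: filtered_projection.
  exact: local_ls_bounded.
have SwE t : 0 <= t -> S t *m w t = g t.
  move=> t0; rewrite /g /w mulmxBr S_thd// mulmxBl (mulmxBl (S t)).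
  suff -> : Phi *m varphi t = Sbar t *m (Phi *m thstar t).
    by rewrite opprB addrA subrK.
  rewrite -normal// !mulmxDl -!scalemxAl PhiK mulmxBl mul1mx PhiK subrr scaler0 addr0.
  by rewrite mulmxDr -scalemxAr !mulmxA Q_Phil// Q_Phir.
have /sexpO_pos[C C0 DC] : sexpO nn sigma
    (fun t => \sum_i \sum_j `|(S t - Sbar t) i j|).
  apply: sexpO_sum => i; apply: sexpO_sum => j.
  by apply: sexpO_le (DO i j) => t _; rewrite normr_id.
(* From [b] on, [expR (sigma * t) >= 1 + sigma * t] gives [C * expR (- (sigma * t)) <= c / 2]. *)
pose b := 2 * C / (c * sigma).
have b0 : 0 < b by rewrite divr_gt0 ?mulr_gt0.
have Cb t : b <= t -> C * expR (- (sigma * t)) <= c / 2.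
  move=> bt; rewrite expRN ler_pdivrMr ?expR_gt0//.
  have := expR_ge1Dx (sigma * t); have : C = c / 2 * (sigma * b).
    by rewrite /b; field; rewrite !gt_eqF.
  have : sigma * b <= sigma * t by rewrite ler_pM2l.
  move=> h1 -> h2; rewrite ler_pM2l ?divr_gt0//; lra.
have wO1 : expO [set t | 0 <= t <= b] 0 w.
  apply: expOB; first by move=> i j; exact: sexpO_ode (thdo i j).
  by apply: expO_sub local_ls_bounded => t /= /andP[].
have wO2 : expO [set t | b <= t] sigma w.
  have c2 : 0 < c / 2 by rewrite divr_gt0.
  apply: (expO_coercive c2 (g := g)).
    move=> t /= bt; have t0 : 0 <= t by exact: le_trans (ltW b0) bt.
    have := cP t (w t) t0; rewrite -SwE//.
    have -> : S t = Sbar t + (S t - Sbar t) by rewrite addrC subrK.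
    rewrite (mulmxDl (Sbar t)) (dotvDr _ (Sbar t *m w t)); have := dotv_mx_le (S t - Sbar t) (w t).
    have := DC t t0; rewrite ger0_norm ?sum_norm_entry_ge0// => H1.
    rewrite ler_norml => /andP[H2 _].
    have : (\sum_i \sum_j `|(S t - Sbar t) i j|) * dotv (w t) (w t) <=
        c / 2 * dotv (w t) (w t).
      by rewrite ler_wpM2r ?dotvv_ge0// (le_trans H1)// Cb.
    by lra.
  by apply: expO_sub gO => t /=; exact: le_trans (ltW b0).
by move=> i j; exact: sexpO_glue (wO1 i j) (wO2 i j).
Qed.

Lemma projected_estimate_error sigma : 0 < sigma -> sigma < gamma ->
  expO nn sigma (fun t => P t *m thd t - Phi *m thstar t).
Proof.
move=> s0 sg; have wO := thd_error s0 sg.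
apply: (@expO_ext _ _ _ _ _ (fun t => P t *m (thd t - Phi *m thstar t) +
    (P t - Phi) *m (Phi *m thstar t))).
  by move=> t _; rewrite mulmxBr mulmxBl PhiK addrA subrK.
apply: expOD; first exact: expOMr.
by apply: expOMl; [exact: filtered_projection|exact: local_ls_bounded].
Qed.

End node_convergence.

(** * Consensus in the non-PE subspaces *)

Section consensus.
Variables (R : realType) (N n : nat) (E : rel 'I_N) (a : 'M[R]_N).
Local Notation nn := (@nonneg_times R).
Variable Phi : 'I_N -> 'M[R]_n.
Hypotheses (wa : weighted_adjacency E a).
Hypothesis Phi_proj : forall i, orthogonal_projection (Phi i).

Definition consensus (w : 'I_N -> 'cV[R]_n) i : 'cV[R]_n :=
  \sum_j a i j *: (w i - w j).

Lemma consensusD v w i :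
  consensus (fun j => v j + w j) i = consensus v i + consensus w i.
Proof.
rewrite /consensus -big_split; apply: eq_bigr => j _ /=.
by rewrite -scalerDr opprD addrACA.
Qed.

Lemma consensusZ c w i : consensus (fun j => c *: w j) i = c *: consensus w i.
Proof.
rewrite /consensus scaler_sumr; apply: eq_bigr => j _.
by rewrite -scalerBr !scalerA mulrC.
Qed.

Lemma consensus_cst v i : consensus (fun=> v) i = 0.
Proof. by rewrite /consensus big1// => j _; rewrite subrr scaler0. Qed.

Lemma expO_consensus D rho (w : 'I_N -> R -> 'cV[R]_n) i :
  (forall j, expO D rho (w j)) -> expO D rho (fun t => consensus (w^~ t) i).
Proof.
move=> wO; apply: expO_sum => j; apply: expOZr; first exact: sexpO_cst.
exact: expOB.
Qed.

(** The inverse of one plus the sum of the inverses replaces a minimum, so that [N = 0] needs no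
    separate case. *)
Lemma ord_pos_lower_bound (f : 'I_N -> R) : (forall i, 0 < f i) ->
  exists2 c, 0 < c & forall i, c <= f i.
Proof.
move=> f0; have s0 : 0 <= \sum_i (f i)^-1.
  by apply: sumr_ge0 => i _; rewrite invr_ge0 ltW.
have s1 : 0 < 1 + \sum_i (f i)^-1 by rewrite ltr_pwDl.
exists (1 + \sum_i (f i)^-1)^-1; first by rewrite invr_gt0.
move=> i; rewrite -[leRHS]invrK lef_pV2 ?posrE ?invr_gt0//.
rewrite (bigD1 i)//= addrCA lerDl addr_ge0// sumr_ge0// => j _.
by rewrite invr_ge0 ltW.
Qed.

Section weighted_energy.
Variables (xi : 'I_N -> R) (eta : 'I_N -> R).
Hypothesis xi_gt0 : forall i, 0 < xi i.
Hypothesis xiE : forall j, xi j * \sum_k a j k = \sum_i xi i * a i j.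
Hypothesis eta_gt0 : forall i, 0 < eta i.

Definition energy (y : 'I_N -> 'cV[R]_n) :=
  \sum_i xi i / eta i * dotv (y i) (y i).

Let w_gt0 i : 0 < xi i / eta i. Proof. by rewrite divr_gt0. Qed.

Lemma energy_ge0 y : 0 <= energy y.
Proof.
by apply: sumr_ge0 => i _; apply: mulr_ge0; [exact: ltW|exact: dotvv_ge0].
Qed.

Lemma energy_lower y i : dotv (y i) (y i) <= (xi i / eta i)^-1 * energy y.
Proof.
rewrite mulrC ler_pdivlMr// mulrC /energy (bigD1 i)//= lerDl sumr_ge0// => j _.
by apply: mulr_ge0; [exact: ltW|exact: dotvv_ge0].
Qed.

Lemma ode_dotvv m (y g : R -> 'cV[R]_m) : mxode y g ->
  ode (fun t => dotv (y t) (y t)) (fun t => 2 * dotv (y t) (g t)).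
Proof.
move=> yo; apply: ode_ext (mxodeM (mxode_tr yo) yo 0 0) => // t _.
rewrite mxE -/(dotv (g t) (y t)) -/(dotv (y t) (g t)) dotvC; ring.
Qed.

Lemma ode_energy (y g : 'I_N -> R -> 'cV[R]_n) : (forall i, mxode (y i) (g i)) ->
  ode (fun t => energy (y^~ t))
    (fun t => \sum_i xi i / eta i * (2 * dotv (y i t) (g i t))).
Proof. by move=> yo; apply: ode_sum => i; apply/odeZ/ode_dotvv. Qed.

(** The projection drops out because [1%:M - Phi i] is symmetric and fixes [y i]; the weight
    [xi i / eta i] cancels the gain and leaves the disagreement. *)
Lemma energy_dissipation (y f : 'I_N -> 'cV[R]_n) :
  (forall i, Phi i *m y i = 0) ->
  \sum_i xi i / eta i * (2 * dotv (y i)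
     (- (eta i *: ((1%:M - Phi i) *m consensus y i)) + f i)) =
  - disagreement a xi y + \sum_i xi i / eta i * (2 * dotv (y i) (f i)).
Proof.
move=> y0; rewrite (disagreementE y xiE) mulr_sumr -sumrN -big_split/=.
apply: eq_bigr => i _; rewrite dotvDr dotvNr dotvZr dotv_mulr.
have [_ ->] := orthogonal_projectionC (Phi_proj i).
by rewrite mulmxBl mul1mx y0 subr0 -/(consensus y i); field; rewrite gt_eqF.
Qed.

End weighted_energy.

(* The rate is limited by [eta] only through a constant of the graph and of the
   local PE subspaces. *)
Lemma consensus_contraction : strongly_connected E -> posdef (\sum_i Phi i) ->
  exists2 c, 0 < c & forall (eta : 'I_N -> R) (y g f : 'I_N -> R -> 'cV[R]_n) rho,
  (forall i, 0 < eta i) -> (forall i, rho < c * eta i) ->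
  (forall i t, 0 <= t -> Phi i *m y i t = 0) ->
  (forall i, mxode (y i) (g i)) ->
  (forall i t, 0 < t -> g i t =
     - (eta i *: ((1%:M - Phi i) *m consensus (y^~ t) i)) + f i t) ->
  (forall i, expO nn rho (f i)) -> forall i, expO nn rho (y i).
Proof.
move=> sc Ppos; have [xi [xi0 xiE]] := laplacian_left_null wa sc.
have [c1 c10 c1P] := disagreement_coercive wa sc xi0 Phi_proj Ppos.
pose X := 1 + \sum_i xi i.
have X0 : 0 < X by rewrite ltr_pwDl// sumr_ge0// => i _; exact: ltW.
have xiX i : xi i <= X.
  rewrite /X (bigD1 i)//= addrCA lerDl addr_ge0// sumr_ge0// => j _; exact: ltW.
(* As [xi i <= X], the condition [rho < c1 / (2 * X) * eta i] implies
   [2 * rho * (xi i / eta i) < c1], uniformly in the gains. *)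
exists (c1 / (2 * X)) => [|eta y g f rho eta0 rho_lt y0 yo gE fO].
  by rewrite divr_gt0// mulr_gt0.
pose w i := xi i / eta i.
have w0 i : 0 < w i by exact: divr_gt0.
(* The dissipation left over after the decay rate [2 * rho] of the energy has been paid for. One
   half absorbs the forcing through Young's inequality; the other half provides the margin [d] that
   makes the comparison rate exceed that of the forcing strictly. *)
pose gap i := c1 - 2 * rho * w i.
have gap0 i : 0 < gap i.
  have h1 : 2 * rho * w i < c1 * (xi i / X).
    have -> : c1 * (xi i / X) = 2 * (c1 / (2 * X) * eta i) * w i.
      by rewrite /w; field; rewrite !gt_eqF.
    by rewrite ltr_pM2r// ltr_pM2l.
  rewrite subr_gt0 (lt_le_trans h1)// ler_piMr ?(ltW c10)//.
  by rewrite ler_pdivrMr// mul1r.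
have [d d0 dP] := @ord_pos_lower_bound (fun i => gap i / (4 * w i))
  (fun i => divr_gt0 (gap0 i) (mulr_gt0 (ltr0Sn _ 3) (w0 i))).
have mu_le i : 2 * (rho + d) * w i + gap i / 2 <= c1.
  have := dP i; rewrite (ler_pdivlMr _ _ (mulr_gt0 (ltr0Sn _ 3) (w0 i))) => H.
  have : gap i = c1 - 2 * rho * w i by [].
  lra.
have /sexpO_pos[K K0 fK] : sexpO nn (rho + rho)
    (fun t => \sum_i w i ^+ 2 * (gap i / 2)^-1 * dotv (f i t) (f i t)).
  apply: sexpO_sum => i; apply: sexpOMr; first exact: sexpO_cst.
  exact: sexpO_dotv.
pose V t := energy xi eta (y^~ t).
have Vo := ode_energy xi eta yo.
have V0 t : 0 <= V t by exact: energy_ge0.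
have Vle := @ode_decay R _ _ (2 * (rho + d)) (rho + rho) K Vo _ (ltW K0) _.
have {}Vle t : 0 <= t ->
    V t <= (`|V 0| + K / (2 * (rho + d) - (rho + rho))) * expR (- ((rho + rho) * t)).
  apply: Vle => [|{}t t0]; first by lra.
  have t0' := ltW t0.
  under eq_bigr do rewrite gE//.
  rewrite (energy_dissipation xiE eta0 (fun i => f i t))//; last first.
    by move=> i; exact: y0.
  have H1 := c1P (y^~ t) (fun i => y0 i t t0').
  have H2 : \sum_i w i * (2 * dotv (y i t) (f i t)) <=
      \sum_i gap i / 2 * dotv (y i t) (y i t) +
      \sum_i w i ^+ 2 * (gap i / 2)^-1 * dotv (f i t) (f i t).
    rewrite -big_split; apply: ler_sum => i _ /=.
    have := dotv_young (y i t) (w i *: f i t) (divr_gt0 (gap0 i) (ltr0Sn _ 1)).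
    by rewrite !dotvZr dotvZl; lra.
  have H3 := le_trans (ler_norm _) (fK t t0').
  have H4 : 2 * (rho + d) * V t + \sum_i gap i / 2 * dotv (y i t) (y i t) <=
      c1 * \sum_i dotv (y i t) (y i t).
    rewrite /V /energy !mulr_sumr -big_split; apply: ler_sum => i _ /=.
    rewrite mulrA -mulrDl ler_wpM2r ?dotvv_ge0//.
    exact: mu_le.
  rewrite -/(V t); lra.
move=> i; apply: expO_dotvv.
apply: (@sexpO_le _ _ _ _ (fun t => (w i)^-1 * V t)) => [t t0|].
  rewrite !ger0_norm ?dotvv_ge0 ?mulr_ge0 ?invr_ge0 ?(ltW (w0 i))//.
  exact: energy_lower.
apply: sexpOMr; first exact: sexpO_cst.
by eexists=> t t0; rewrite ger0_norm//; exact: Vle.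
Qed.

End consensus.

(** * The network as a perturbation of the reference system *)

Section network.
Variables (R : realType) (N n : nat) (E : rel 'I_N) (a : 'M[R]_N).
Local Notation nn := (@nonneg_times R).
Variables (Phi : 'I_N -> 'M[R]_n) (theta : 'cV[R]_n).
Hypotheses (wa : weighted_adjacency E a) (sc : strongly_connected E).
Hypothesis Phi_proj : forall i, orthogonal_projection (Phi i).
Variables (sigma : R) (ed eu : 'I_N -> R) (P : 'I_N -> R -> 'M[R]_n).
Variables (thd thu x thstar : 'I_N -> R -> 'cV[R]_n).
Hypotheses (sigma0 : 0 < sigma) (ed0 : forall i, 0 < ed i).
Hypothesis (eu0 : forall i, 0 < eu i).
Hypothesis PO : forall i, expO nn sigma (fun t => P i t - Phi i).
Hypothesis thdO : forall i,
  expO nn sigma (fun t => P i t *m thd i t - Phi i *m thstar i t).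
Hypothesis thstarO : forall i, expO nn 0 (fun t => Phi i *m thstar i t).

Definition network_estimate i t := P i t *m thd i t + (1%:M - P i t) *m thu i t.
Local Notation est := network_estimate.

Definition reference i t := x i t + Phi i *m (thstar i t - theta).

Hypothesis thuo : forall i, mxode (thu i) (fun t => - (ed i *: (P i t *m thu i t))
  - eu i *: ((1%:M - P i t) *m consensus a (est^~ t) i)).
Hypothesis xo : forall i, mxode (x i) (fun t =>
  - (eu i *: ((1%:M - Phi i) *m consensus a (reference^~ t) i))).
Hypothesis Phi_x : forall i t, 0 <= t -> Phi i *m x i t = 0.
Hypothesis xO : forall i, expO nn 0 (x i).

Let PhiPhi i : Phi i *m Phi i = Phi i. Proof. by have [] := Phi_proj i. Qed.
Let nn0 : forall t : R, nn t -> 0 <= t. Proof. by []. Qed.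

Let PhiC i : Phi i *m (1%:M - Phi i) = 0.
Proof. by rewrite mulmxBr mulmx1 PhiPhi subrr. Qed.

Let PbO i : expO nn 0 (P i).
Proof.
apply: expO_ext (expOD (expO_weak nn0 (ltW sigma0) (@PO i)) (expO_cst nn (Phi i))).
by move=> t _; rewrite subrK.
Qed.

(** The deviation of [thu] from the reference inside the kernel of [Phi i]. It is accompanied by
    [d], the component of [thu] in the image of [Phi i], which damps itself, and by [h], which
    collects what is due to [P] and [P thd] not having reached their limits. The terms [f] and [g]
    are the resulting forcings of [y] and [d]. *)
Let y i t := (1%:M - Phi i) *m (thu i t - theta) - x i t.
Let d i t := Phi i *m thu i t.
Let h i t := P i t *m thd i t - Phi i *m thstar i t - (P i t - Phi i) *m thu i t.
Let f i t := - (eu i *: ((1%:M - Phi i) *m consensus a (h^~ t) i))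
  + eu i *: ((1%:M - Phi i) *m (P i t - Phi i) *m consensus a (est^~ t) i)
  - ed i *: ((1%:M - Phi i) *m (P i t - Phi i) *m thu i t).
Let g i t := eu i *: (Phi i *m (P i t - Phi i) *m consensus a (est^~ t) i)
  - ed i *: (Phi i *m (P i t - Phi i) *m thu i t).

Let Phi_y i t : 0 <= t -> Phi i *m y i t = 0.
Proof. by move=> t0; rewrite mulmxBr mulmxA PhiC mul0mx Phi_x// subr0. Qed.

Let estE i t : est i t = theta + (y i t + (reference i t + h i t)).
Proof.
rewrite /network_estimate /y /h /reference !(mulmxBl, mulmxBr) !mul1mx.
move: (P i t *m thd i t) (P i t *m thu i t) (Phi i *m thu i t)
  (Phi i *m thstar i t) (Phi i *m theta) => A B C D F.
by apply/matrixP => k l; rewrite !mxE; ring.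
Qed.

Let thuE i t : thu i t = y i t + d i t + (x i t + (1%:M - Phi i) *m theta).
Proof.
rewrite /y /d !(mulmxBl, mulmxBr) !mul1mx.
by apply/matrixP => k l; rewrite !mxE; ring.
Qed.

Let y_ode i : mxode (y i) (fun t =>
  - (eu i *: ((1%:M - Phi i) *m consensus a (y^~ t) i)) + f i t).
Proof.
apply: mxode_ext (mxodeB (mxodeMl (1%:M - Phi i)
  (mxodeB (thuo i) (mxode_cst theta))) (xo i)) => // t _.
have CP : (1%:M - Phi i) *m (P i t - Phi i) = (1%:M - Phi i) *m P i t.
  by rewrite mulmxBr [X in _ - X](_ : _ = 0) ?subr0// mulmxBl mul1mx PhiPhi subrr.
have estC : consensus a (est^~ t) i = consensus a (y^~ t) i +
    (consensus a (reference^~ t) i + consensus a (h^~ t) i).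
  rewrite -!consensusD -[RHS]add0r -[X in X + _](consensus_cst a theta i) -consensusD.
  by congr consensus; apply/funext => j; exact: estE.
rewrite subr0 /f; move: (1%:M - Phi i) CP => K CP; rewrite !CP.
have KE : K *m consensus a (est^~ t) i = K *m consensus a (y^~ t) i +
    (K *m consensus a (reference^~ t) i + K *m consensus a (h^~ t) i).
  by rewrite estC !mulmxDr.
rewrite (mulmxBr K) mulmxN -!scalemxAr !mulmxA (mulmxBr K) mulmx1 (mulmxBl K) KE.
move: (K *m P i t *m thu i t) (K *m P i t *m consensus a (est^~ t) i)
  (K *m consensus a (y^~ t) i) (K *m consensus a (reference^~ t) i)
  (K *m consensus a (h^~ t) i) => A B C D F.
by apply/matrixP => k l; rewrite !mxE; ring.
Qed.

Let d_ode i : mxode (d i) (fun t => - (ed i *: d i t) + g i t).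
Proof.
apply: mxode_ext (mxodeMl (Phi i) (thuo i)) => // t _.
rewrite /g /d mulmxBr mulmxN -!scalemxAr !mulmxA.
rewrite !(mulmxBr (Phi i)) PhiPhi mulmx1 !mulmxBl.
move: (Phi i *m P i t *m thu i t) (Phi i *m thu i t) (Phi i *m P i t *m _)
  (Phi i *m consensus a (est^~ t) i) => A B C D.
by apply/matrixP => k l; rewrite !mxE; ring.
Qed.

Section weighted_forcing.
Variable s : R -> R.
Hypothesis sO : sexpO nn 0 s.
Hypothesis sthuO : forall i, expO nn 0 (fun t => s t *: thu i t).

(** The weight [s] lets the same estimates serve twice: with [s] the inverse square root of [1 + V],
    before [thu] is known to be bounded, and with [s = 1] afterwards. *)
Lemma weighted_mismatch i : expO nn sigma (fun t => s t *: h i t).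
Proof.
apply: expO_ext (expOB (expOZr sO (@thdO i)) (expOMl (@PO i) (@sthuO i))).
by move=> t _; rewrite -scalemxAr -scalerBr.
Qed.

Let sestO i : expO nn 0 (fun t => s t *: est i t).
Proof.
apply: (@expO_ext _ _ _ _ _ (fun t => s t *: (P i t *m thd i t - Phi i *m thstar i t) +
   s t *: (Phi i *m thstar i t) + (1%:M - P i t) *m (s t *: thu i t))).
  by move=> t _; rewrite -scalerDr subrK -scalemxAr -scalerDr.
apply: expOD; first apply: expOD.
- by apply: expOZr => //; exact: expO_weak (ltW sigma0) (@thdO i).
- exact: expOZr.
- by apply: expOMr => //; apply: expOB => //; exact: expO_cst.
Qed.

Let sPO (A : 'M[R]_n) (v : R -> 'cV[R]_n) i : expO nn 0 (fun t => s t *: v t) ->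
  expO nn sigma (fun t => s t *: (A *m (P i t - Phi i) *m v t)).
Proof.
move=> vO; apply: expO_ext (expOMl (expOMr (expO_cst nn A) (@PO i)) vO).
by move=> t _; rewrite -scalemxAr.
Qed.

Let sconsO i : expO nn 0 (fun t => s t *: consensus a (est^~ t) i).
Proof.
have := @expO_consensus R N n a nn 0 (fun j t => s t *: est j t) i sestO.
by apply: expO_ext => t _; rewrite consensusZ.
Qed.

Lemma weighted_forcing_y i : expO nn sigma (fun t => s t *: f i t).
Proof.
apply: (@expO_ext _ _ _ _ _ (fun t =>
  - (eu i *: ((1%:M - Phi i) *m consensus a (fun j => s t *: h j t) i)) +
  eu i *: (s t *: ((1%:M - Phi i) *m (P i t - Phi i) *m consensus a (est^~ t) i)) -
  ed i *: (s t *: ((1%:M - Phi i) *m (P i t - Phi i) *m thu i t)))).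
  move=> t _; rewrite consensusZ -scalemxAr !(scalerA _ (s t)) ![_ * s t]mulrC.
  by rewrite -!scalerA -scalerN -scalerDr -scalerBr.
apply: expOB; last by apply: expOZr; [exact: sexpO_cst|exact: sPO].
apply: expOD; last by apply: expOZr; [exact: sexpO_cst|exact: sPO].
apply: expON; apply: expOZr; first exact: sexpO_cst.
apply: expOMr; first exact: expO_cst.
by apply: (@expO_consensus _ _ _ a nn sigma (fun j t => s t *: h j t)) => j; exact: weighted_mismatch.
Qed.

Lemma weighted_forcing_d i : expO nn sigma (fun t => s t *: g i t).
Proof.
apply: (@expO_ext _ _ _ _ _ (fun t =>
  eu i *: (s t *: (Phi i *m (P i t - Phi i) *m consensus a (est^~ t) i)) -
  ed i *: (s t *: (Phi i *m (P i t - Phi i) *m thu i t)))).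
  by move=> t _; rewrite !(scalerA _ (s t)) ![_ * s t]mulrC -!scalerA -scalerBr.
by apply: expOB; (apply: expOZr; [exact: sexpO_cst|exact: sPO]).
Qed.

End weighted_forcing.

(* With [V] the energy of [y] plus that of [d], all signals scaled by
   [(1 + V)^-(1/2)] are bounded; hence V' <= C e^(-sigma t) (1 + V), whose
   coefficient is integrable. *)
Lemma network_bounded i : expO nn 0 (thu i).
Proof.
have [xi [xi0 xiE]] := laplacian_left_null wa sc.
pose V t := energy xi eu (y^~ t) + \sum_i dotv (d i t) (d i t).
have en0 t : 0 <= energy xi eu (y^~ t) by exact: energy_ge0.
have dn0 t : 0 <= \sum_i dotv (d i t) (d i t).
  by apply: sumr_ge0 => j _; exact: dotvv_ge0.
have V0 t : 0 <= V t by rewrite addr_ge0.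
have V1 t : 0 < 1 + V t by rewrite ltr_pwDl.
pose s t := (Num.sqrt (1 + V t))^-1.
have s2 t : s t ^+ 2 = (1 + V t)^-1 by rewrite exprVn sqr_sqrtr// ltW.
have s0 t : 0 <= s t by rewrite invr_ge0 sqrtr_ge0.
have s2V t : s t ^+ 2 * V t <= 1.
  by rewrite s2 mulrC ler_pdivrMr// mul1r lerDr.
have sO : sexpO nn 0 s.
  apply: (@sexpO_bounded _ _ 1) => t _; rewrite ger0_norm//.
  rewrite -(@ler_pXn2r _ 2)// ?nnegrE// expr1n s2 invf_le1// lerDl//.
have scaled_bounded (v : R -> 'cV[R]_n) c : 0 <= c ->
    (forall t, dotv (v t) (v t) <= c * V t) -> expO nn 0 (fun t => s t *: v t).
  move=> c0 vV; apply: expO_dotvv; rewrite addr0.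
  apply: (@sexpO_bounded _ _ c) => t _; rewrite ger0_norm ?dotvv_ge0//.
  rewrite dotvZl dotvZr mulrA -expr2 (le_trans (ler_wpM2l (sqr_ge0 _) (vV t)))//.
  by rewrite mulrCA ler_piMr.
have syO j : expO nn 0 (fun t => s t *: y j t).
  apply: (scaled_bounded (y j) (xi j / eu j)^-1) => [|t].
    by rewrite invr_ge0 ltW// divr_gt0.
  apply: (le_trans (energy_lower xi0 eu0 (y^~ t) j)).
  by rewrite ler_wpM2l ?lerDl// invr_ge0 ltW// divr_gt0.
have sdO j : expO nn 0 (fun t => s t *: d j t).
  apply: (scaled_bounded (d j) 1) => // t; rewrite mul1r.
  apply: (@le_trans _ _ (\sum_i dotv (d i t) (d i t))); last by rewrite lerDr.
  by rewrite (bigD1 j)//= lerDl sumr_ge0// => k _; exact: dotvv_ge0.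
have sthuO j : expO nn 0 (fun t => s t *: thu j t).
  apply: (expO_ext (fun t _ => congr1 (fun v => s t *: v) (esym (thuE j t)))).
  apply: (@expO_ext _ _ _ _ _ (fun t => s t *: y j t + s t *: d j t +
     s t *: (x j t + (1%:M - Phi j) *m theta))).
    by move=> t _; rewrite -!scalerDr.
  apply: expOD; first exact: expOD.
  by apply: expOZr => //; apply: expOD => //; exact: expO_cst.
have /sexpO_pos[C C0 CP] : sexpO nn sigma (fun t =>
    \sum_j xi j / eu j * (2 * dotv (s t *: y j t) (s t *: f j t)) +
    \sum_j 2 * dotv (s t *: d j t) (s t *: g j t)).
  apply: sexpOD; apply: sexpO_sum => j.
    apply: sexpOMr; first exact: sexpO_cst.
    apply: sexpOMr; first exact: sexpO_cst.
    by rewrite -[sigma]add0r; apply: sexpO_dotv => //; exact: weighted_forcing_y.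
  apply: sexpOMr; first exact: sexpO_cst.
  by rewrite -[sigma]add0r; apply: sexpO_dotv => //; exact: weighted_forcing_d.
have Vo := odeD (ode_energy xi eu y_ode)
  (ode_sum (index_enum _) (fun j => ode_dotvv (d_ode j))).
have dV t : 0 < t ->
    \sum_i xi i / eu i * (2 * dotv (y i t)
       (- (eu i *: ((1%:M - Phi i) *m consensus a (y^~ t) i)) + f i t)) +
    \sum_i 2 * dotv (d i t) (- (ed i *: d i t) + g i t) <=
    C * expR (- (sigma * t)) * (1 + V t).
  move=> t0; have t0' := ltW t0.
  rewrite (energy_dissipation Phi_proj xiE eu0)//; last by move=> j; exact: Phi_y.
  have := le_trans (ler_norm _) (CP t t0').
  have -> : \sum_j xi j / eu j * (2 * dotv (s t *: y j t) (s t *: f j t)) +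
      \sum_j 2 * dotv (s t *: d j t) (s t *: g j t) =
      (\sum_j xi j / eu j * (2 * dotv (y j t) (f j t)) +
       \sum_j 2 * dotv (d j t) (g j t)) / (1 + V t).
    rewrite -s2 mulrDl !mulr_suml; congr (_ + _); apply: eq_bigr => j _;
      rewrite dotvZl dotvZr; ring.
  rewrite ler_pdivrMr// => H.
  have H1 := disagreement_ge0 wa xi0 (y^~ t).
  have H2 : \sum_i 2 * dotv (d i t) (- (ed i *: d i t) + g i t) <=
      \sum_i 2 * dotv (d i t) (g i t).
    apply: ler_sum => j _; rewrite dotvDr dotvNr dotvZr.
    have := mulr_ge0 (ltW (ed0 j)) (dotvv_ge0 (d j t)); lra.
  lra.
(* An integrating factor: its logarithmic derivative is [- (C * expR (- (sigma * t)))], so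
   [(1 + V t) * k t] is nonincreasing, while [k] stays between 1 and [expR (C / sigma)]. *)
pose k t := expR (C / sigma * expR (- (sigma * t))).
have ko : ode k (fun t => - (C * expR (- (sigma * t))) * k t).
  apply: ode_ext (ode_expR_comp (odeZ (C / sigma) (ode_expRN sigma))) => // t _.
  by rewrite /k; field; rewrite gt_eqF.
have Vb t : 0 <= t -> V t <= (1 + V 0) * expR (C / sigma).
  move=> t0; have := ode_le (odeM (odeD (ode_cst 1) Vo) ko) (lexx 0) t0.
  rewrite -!/(V _) => H.
  have {H} : (1 + V t) * k t <= (1 + V 0) * k 0.
    apply: H => u /andP[u0 _]; have := dV u u0; have : 0 < k u by exact: expR_gt0.
    rewrite add0r -/(V u) => k0 WV; have := ler_wpM2r (ltW k0) WV.
    by rewrite mulNr mulrN -subr_le0 mulrAC mulrC [C * _ * k u * _]mulrC.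
  rewrite {2}/k mulr0 oppr0 expR0 mulr1; apply: le_trans.
  have k1 : 1 <= k t.
    by rewrite -[leLHS]expR0 ler_expR mulr_ge0 ?expR_ge0// divr_ge0 ?ltW.
  rewrite (@le_trans _ _ (1 + V t))//; first by rewrite lerDr.
  by rewrite ler_peMr// ltW.
have bounded (v : R -> 'cV[R]_n) c : 0 <= c ->
    (forall t, dotv (v t) (v t) <= c * V t) -> expO nn 0 v.
  move=> c0 vV; apply: expO_dotvv; rewrite addr0.
  apply: (@sexpO_bounded _ _ (c * ((1 + V 0) * expR (C / sigma)))) => t t0.
  by rewrite ger0_norm ?dotvv_ge0// (le_trans (vV t))// ler_wpM2l// Vb.
apply: (expO_ext (fun t _ => esym (thuE i t))).
apply: expOD; last by apply: expOD => //; exact: expO_cst.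
apply: expOD.
  apply: (bounded (y i) (xi i / eu i)^-1) => [|t].
    by rewrite invr_ge0 ltW// divr_gt0.
  apply: (le_trans (energy_lower xi0 eu0 (y^~ t) i)).
  by rewrite ler_wpM2l ?lerDl// invr_ge0 ltW// divr_gt0.
apply: (bounded (d i) 1) => // t; rewrite mul1r.
apply: (@le_trans _ _ (\sum_i dotv (d i t) (d i t))); last by rewrite lerDr.
by rewrite (bigD1 i)//= lerDl sumr_ge0// => k0 _; exact: dotvv_ge0.
Qed.

(** Boundedness of [thu] makes the forcing estimates available with weight 1. The tracking error is
    then [y i t + h i t]: the contraction gives the rate of the first term and the mismatch estimate
    that of the second. *)
Lemma network_tracking rho : rho < sigma ->
  (forall (y' g' f' : 'I_N -> R -> 'cV[R]_n),
    (forall i t, 0 <= t -> Phi i *m y' i t = 0) ->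
    (forall i, mxode (y' i) (g' i)) ->
    (forall i t, 0 < t -> g' i t =
       - (eu i *: ((1%:M - Phi i) *m consensus a (y'^~ t) i)) + f' i t) ->
    (forall i, expO nn rho (f' i)) -> forall i, expO nn rho (y' i)) ->
  forall i, expO nn rho (fun t => est i t - theta - reference i t).
Proof.
move=> rs contr i.
have one : sexpO nn 0 (fun=> 1 : R) by exact: sexpO_cst.
have sthu j : expO nn 0 (fun t => 1 *: thu j t).
  by apply: expO_ext (network_bounded j) => t _; rewrite scale1r.
have fO j : expO nn rho (f j).
  apply: expO_ext (expO_weak nn0 (ltW rs) (weighted_forcing_y one sthu j)).
  by move=> t _; rewrite scale1r.
have hO j : expO nn rho (h j).
  apply: expO_ext (expO_weak nn0 (ltW rs) (weighted_mismatch one sthu j)).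
  by move=> t _; rewrite scale1r.
have yO := contr y _ f Phi_y y_ode (fun _ _ _ => erefl) fO.
apply: expO_ext (expOD (yO i) (hO i)) => t _; rewrite estE.
by apply/matrixP => k l; rewrite !mxE; ring.
Qed.

End network.

(** * Stacked trajectories *)

Section block_matrices.
Variables (R : realType) (N : nat).

Lemma mul_blkdiag (p_ q_ : 'I_N -> nat) m (B : forall i, 'M[R]_(p_ i, q_ i))
    (v : forall i, 'M[R]_(q_ i, m)) :
  blkdiag B *m \mxcol_i v i = \mxcol_i (B i *m v i).
Proof.
rewrite /blkdiag mul_mxblock_mxrow; apply/eq_mxcol => i.
rewrite (bigD1 i)//= eqxx conform_mx_id big1 ?addr0// => j ji.
by rewrite eq_sym (negbTE ji) mul0mx.
Qed.

Lemma tr_blkdiag (p_ q_ : 'I_N -> nat) (B : forall i, 'M[R]_(p_ i, q_ i)) :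
  (blkdiag B)^T = blkdiag (fun i => (B i)^T).
Proof.
rewrite /blkdiag tr_mxblock; apply/eq_mxblock => i j; rewrite eq_sym.
by case: eqVneq => [->|_]; rewrite ?conform_mx_id ?trmx0.
Qed.

Lemma expO_mxcol D rho (p_ : 'I_N -> nat) m (w : forall i, R -> 'M[R]_(p_ i, m)) :
  (forall i, expO D rho (w i)) -> expO D rho (fun t => \mxcol_i w i t).
Proof.
move=> wO s k; apply: sexpO_ext (wO (tagnat.sig1 s) (tagnat.sig2 s) k) => t _.
by rewrite mxE.
Qed.

Lemma mxode_submxcol (p_ : 'I_N -> nat) m (X F : R -> 'M[R]_(\sum_i p_ i, m)) i :
  mxode X F -> mxode (fun t => submxcol (X t) i) (fun t => submxcol (F t) i).
Proof.
by move=> Xo j k; apply: ode_ext (Xo (tagnat.Rank i j) k) => t; rewrite mxE.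
Qed.

Lemma kron_laplacian n (E : rel 'I_N) (a : 'M[R]_N) (r : 'I_N -> 'cV[R]_n) :
  weighted_adjacency E a ->
  kron_id n (laplacian a) *m \mxcol_i r i = \mxcol_i consensus a r i.
Proof.
move=> [_ _ aii]; rewrite /kron_id mul_mxblock_mxrow; apply/eq_mxcol => i.
rewrite /consensus; under [RHS]eq_bigr do rewrite scalerBr.
rewrite sumrB -scaler_suml (bigD1 i)//= mul_scalar_mx mxE eqxx; congr (_ + _).
rewrite [X in - X](bigD1 i)//= aii scale0r add0r -sumrN; apply: eq_bigr => j ji.
by rewrite mul_scalar_mx mxE eq_sym (negbTE ji) scaleNr.
Qed.

End block_matrices.

(** * The sampled kernel projections of a node of the algorithm *)

Section node_instance.
Variable R : realType.
Local Notation nn := (@nonneg_times R).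
Variables (n q : nat) (T alpha beta gamma delta kappa : R) (Phi : 'M[R]_n).
Variables (phi : R -> 'cV[R]_n) (s : node_state R n).
Hypotheses (T0 : 0 < T) (beta0 : 0 < beta) (gamma0 : 0 < gamma) (delta0 : 0 < delta).
Hypothesis phic : forall i, {within `[0, +oo[, continuous (fun t => phi t i 0)}.
Hypothesis phi_ppe : ppe T phi q Phi.
Hypothesis Qi : ivp (nQ s) 0 (fun t => - (beta *: nQ s t) + phi t *m (phi t)^T).
Hypothesis Nker : forall k : nat, orthonormal_basis_ker (nQ s (k%:R * delta)) (nNhat s k).

(** The left-hand side is [- gamma] times the deviation of the filtered kernel projections from
    [1%:M - Phi]. The samples coincide with [1%:M - Phi] from time [T] on, and their entries are
    bounded by 1 before. *)
Lemma Pdot_filter : expO nn gamma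
  (fun t => Pdot gamma delta s t + gamma *: (nP s t - Phi)).
Proof.
have [Q0 Qode] := Qi; have Qo := ode_mx Qode.
have Pproj : orthogonal_projection Phi by have [] := phi_ppe.
move=> i j; pose G k := (nNhat s k *m (nNhat s k)^T) i j.
have G1 k : `|G k| <= 1.
  have [BB _] := Nker k.
  exact: proj_entry_le1 (orthogonal_projectionBB BB).
have Gc k : T <= k%:R * delta -> G k = (1%:M - Phi) i j.
  move=> Tk; rewrite /G (orthonormal_ker_proj Pproj (Nker k))//.
    rewrite mulmxBr mulmx1 (gramian_projr T0 phic phi_ppe Q0 Qo) ?subrr//.
    exact: le_trans (ltW T0) Tk.
  by move=> v; exact: (gramian_ker T0 beta0 phic phi_ppe Q0 Qo Tk).
have := sampled_filter gamma0 delta0 G1 Gc.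
move=> /(sexpOMr (sexpO_cst nn (- gamma))); apply: sexpO_ext => t _.
have -> : \int[lebesgue_measure]_(tau in `[0, t])
    (expR (- (gamma * (t - tau))) * G (Num.truncn (tau / delta))) =
  mxintegral `[0, t] (fun tau => expR (- (gamma * (t - tau))) *:
        (Nbar delta s tau *m (Nbar delta s tau)^T)) i j.
  by rewrite [RHS]mxE; apply: eq_Rintegral => tau _; rewrite [RHS]mxE.
rewrite /Pdot; move: (mxintegral _ _) => I; rewrite !mxE; ring.
Qed.

End node_instance.

Section distributed_learning.
Variables (R : realType) (N n : nat).
Local Notation nn := (@nonneg_times R).
Variables (theta : 'cV[R]_n) (phi : 'I_N -> R -> 'cV[R]_n) (z : 'I_N -> R -> R).
Variables (T : R) (q : 'I_N -> nat) (Phi : 'I_N -> 'M[R]_n).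
Variables (Nd : forall i : 'I_N, 'M[R]_(n, n - q i)).
Variables (Nu : forall i : 'I_N, 'M[R]_(n, q i)).
Variables (E : rel 'I_N) (a : 'M[R]_N).
Variables (alpha beta delta kappa eta_d : 'I_N -> R) (theta0 : 'I_N -> 'cV[R]_n).
Variable thstar : 'I_N -> R -> 'cV[R]_n.
Hypothesis phic : forall i k, {within `[0, +oo[, continuous (fun t => phi i t k 0)}.
Hypothesis phiO : forall i, expO nn 0 (phi i).
Hypothesis zc : forall i, {within `[0, +oo[, continuous (z i)}.
Hypothesis zO : forall i, sexpO nn 0 (z i).
Hypothesis T0 : 0 < T.
Hypothesis phi_ppe : forall i, ppe T (phi i) (q i) (Phi i).
Hypothesis Nd_basis : forall i, orthonormal_basis_im (Phi i) (Nd i).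
Hypothesis Nu_basis : forall i, orthonormal_basis_ker (Phi i) (Nu i).
Hypothesis wa : weighted_adjacency E a.
Hypothesis sc : strongly_connected E.
Hypothesis gains : forall i, [/\ 0 < alpha i, 0 < beta i, 0 < delta i, 0 < kappa i
               & 0 < eta_d i].
Hypothesis ls : forall i,
  ls_solution (alpha i) (beta i) (theta0 i) (phi i) (z i) (thstar i).

Let Phi_proj i : orthogonal_projection (Phi i).
Proof. by have [] := phi_ppe i. Qed.

Let NdNd i : Nd i *m (Nd i)^T = Phi i.
Proof.
have [BB Bim] := Nd_basis i; have [_ Psym] := Phi_proj i.
by apply: orthonormal_proj => //; rewrite -Psym.
Qed.

Let NuNu i : Nu i *m (Nu i)^T = 1%:M - Phi i.
Proof.
have [PP _] := Phi_proj i.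
apply: (orthonormal_ker_proj (Phi_proj i) (Nu_basis i)) => //.
by rewrite mulmxBr mulmx1 PP subrr.
Qed.

Let Phi_Nu i : Phi i *m Nu i = 0.
Proof.
have [BB _] := Nu_basis i; have [PP _] := Phi_proj i.
rewrite -[Nu i]mulmx1 -BB !mulmxA -(mulmxA (Phi i)) NuNu.
by rewrite mulmxBr mulmx1 PP subrr mul0mx.
Qed.

Variables (gamma eta_u : 'I_N -> R) (s : 'I_N -> node_state R n).
Variable thetaU : R -> 'cV[R]_(\sum_(i < N) q i).
Hypothesis gains_pos : forall i, 0 < gamma i /\ 0 < eta_u i.
Hypothesis alg : learning_algorithm alpha beta gamma delta kappa eta_d eta_u a
  theta0 phi z s.
Hypothesis ref : reference_system Nd Nu theta thstar a eta_u thetaU.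

Let x i t := Nu i *m submxcol (thetaU t) i.
Let u i t := Phi i *m (thstar i t - theta).
Let r := reference Phi theta x thstar.

Lemma thetaI_starE t : thetaI_star Nd Nu theta thstar thetaU t = \mxcol_i r i t.
Proof.
rewrite /thetaI_star /thetaD_star /stacked_error tr_blkdiag !mul_blkdiag.
rewrite -[thetaU t]submxcolK mul_blkdiag -mxcolD; apply/eq_mxcol => i.
by rewrite mulmxA NdNd addrC.
Qed.

Let Phi_x i t : 0 <= t -> Phi i *m x i t = 0.
Proof. by move=> _; rewrite mulmxA Phi_Nu mul0mx. Qed.

Let x_ode i : mxode (x i) (fun t =>
  - (eta_u i *: ((1%:M - Phi i) *m consensus a (r^~ t) i))).
Proof.
have [_ /ode_mx/(@mxode_submxcol _ _ _ _ _ _ i)/(mxodeMl (Nu i))] := ref.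
apply: mxode_ext => // t _.
have := thetaI_starE t; rewrite /thetaI_star addrC => ->.
rewrite -!mulmxA (kron_laplacian _ wa) tr_blkdiag mul_blkdiag mul_mxdiag_mxcol.
rewrite submxcolN mxcolK mulmxN mul_scalar_mx -scalemxAr mulmxA NuNu.
by [].
Qed.

Let node_facts i sigma : 0 < sigma -> sigma < gamma i ->
  [/\ expO nn sigma (fun t => nP (s i) t - Phi i),
      expO nn sigma (fun t => nP (s i) t *m nthd (s i) t - Phi i *m thstar i t),
      expO nn 0 (fun t => Phi i *m thstar i t) &
      (forall t, 0 <= t -> z i t = dotv (phi i t) theta) -> expO nn (beta i) (u i)].
Proof.
move=> s0 sg; have [a0 b0 d0 k0 ed0] := gains i; have [g0 eu0] := gains_pos i.
have [Qi [Pi Nker] vi Wi [thdi thui]] := alg i.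
have [Q00 /ode_mx Qo] := Qi; have [P00 /ode_mx Po] := Pi.
have [v00 /ode_mx vo] := vi; have [W00 /ode_mx Wo] := Wi.
have [thd00 /ode_mx thdo] := thdi.
have PE := Pdot_filter T0 b0 g0 d0 (@phic i) (phi_ppe i) Qi Nker.
split.
- exact: (filtered_projection Po PE sg).
- exact: (projected_estimate_error T0 a0 b0 g0 k0 (@phic i) (@zc i) (phiO i) (zO i)
    (phi_ppe i) (ls i) Q00 P00 W00 v00 thd00 Qo Po PE vo Wo thdo s0 sg).
- exact: (local_ls_bounded T0 a0 b0 (@phic i) (@zc i) (phiO i) (zO i)
    (phi_ppe i) (ls i) Q00 v00 Qo vo).
- exact: (noise_free_local_ls T0 a0 b0 (@phic i) (@zc i)
    (phi_ppe i) (ls i) Q00 v00 Qo vo).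
Qed.

Let uO i : expO nn 0 (u i).
Proof.
have [g0 _] := gains_pos i.
have [_ _ bO _] := @node_facts i (gamma i / 2) (divr_gt0 g0 (ltr0Sn _ 1)) ltac:(lra).
apply: expO_ext (expOB bO (expO_cst nn (Phi i *m theta))) => t _.
by rewrite /u mulmxBr.
Qed.

Variable c : R.
Hypothesis c0 : 0 < c.
Hypothesis contraction :
  forall (eta : 'I_N -> R) (y g f : 'I_N -> R -> 'cV[R]_n) rho,
  (forall i, 0 < eta i) -> (forall i, rho < c * eta i) ->
  (forall i t, 0 <= t -> Phi i *m y i t = 0) ->
  (forall i, mxode (y i) (g i)) ->
  (forall i t, 0 < t -> g i t =
     - (eta i *: ((1%:M - Phi i) *m consensus a (y^~ t) i)) + f i t) ->
  (forall i, expO nn rho (f i)) -> forall i, expO nn rho (y i).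

Let eu0 i : 0 < eta_u i. Proof. by have [] := gains_pos i. Qed.

Let x_order rho : (forall i, rho < c * eta_u i) -> (forall i, expO nn rho (u i)) ->
  forall i, expO nn rho (x i).
Proof.
move=> rc uOr.
apply: (contraction (f := fun i t =>
  - (eta_u i *: ((1%:M - Phi i) *m consensus a (u^~ t) i))) eu0 rc Phi_x x_ode).
  move=> i t _; rewrite -opprD -scalerDr -mulmxDr -consensusD.
  by [].
move=> i; apply: expON; apply: expOZr; first exact: sexpO_cst.
apply: expOMr; first exact: expO_cst.
exact: expO_consensus.
Qed.

Lemma estimates_track rho : (forall i, rho < gamma i) ->
  (forall i, rho < c * eta_u i) ->
  expO nn rho (fun t => stacked_error theta (fun i => estimate (s i) t) -
    thetaI_star Nd Nu theta thstar thetaU t).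
Proof.
(* The node estimates need a positive rate strictly between [rho] and every [gamma i], although
   [rho] itself may be negative; [rho' + m / 2] is such a rate. *)
move=> rg rc; pose rho' := Num.max rho 0.
have [m m0 mP] := @ord_pos_lower_bound R N (fun i => gamma i - rho')
  (fun i => ltac:(by rewrite subr_gt0 gt_max rg; have [] := gains_pos i)).
have r0 : 0 <= rho' by rewrite le_max lexx orbT.
have rr : rho <= rho' by rewrite le_max lexx.
have sigma0 : 0 < rho' + m / 2 by rewrite ltr_wpDl// divr_gt0.
have sg i : rho' + m / 2 < gamma i by have := mP i; lra.
have rs : rho < rho' + m / 2 by lra.
have ed0 i : 0 < eta_d i by have [] := gains i.
have thuo i : mxode (nthu (s i)) (fun t => - (eta_d i *: (nP (s i) t *m nthu (s i) t))
    - eta_u i *: ((1%:M - nP (s i) t) *m consensus a (fun j => estimate (s j) t) i)).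
  by have [_ _ _ _ [_ [_ /ode_mx]]] := alg i.
have := network_tracking (theta := theta) (thstar := thstar) (x := x)
  (P := fun i => nP (s i)) (thd := fun i => nthd (s i)) (thu := fun i => nthu (s i))
  wa sc Phi_proj sigma0 ed0 eu0 _ _ _ thuo x_ode Phi_x _ rs _.
have H i := node_facts sigma0 (sg i).
move=> tr; have {tr} tr : forall i, expO nn rho (fun t => estimate (s i) t - theta - r i t).
  apply: tr => [i|i|i|i|y g f].
  - by have [] := H i.
  - by have [] := H i.
  - by have [] := H i.
  - by apply: x_order => // j; rewrite mulr_gt0.
  - exact: contraction eu0 rc.
apply: expO_ext (expO_mxcol tr) => t _.
by rewrite thetaI_starE /stacked_error -mxcolB.
Qed.

Lemma noise_free_reference rho : (forall i t, 0 <= t -> z i t = dotv (phi i t) theta) ->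
  (forall i, rho <= beta i) -> (forall i, rho < c * eta_u i) ->
  expO nn rho (thetaI_star Nd Nu theta thstar thetaU).
Proof.
move=> zE rb rc; have uOr i : expO nn rho (u i).
  have [g0 _] := gains_pos i.
  have [_ _ _ nf] := @node_facts i (gamma i / 2) (divr_gt0 g0 (ltr0Sn _ 1)) ltac:(lra).
  by apply: expO_weak (rb i) (nf (zE i)).
apply: (@expO_ext _ _ _ _ _ (fun t => \mxcol_i r i t)).
  by move=> t _; rewrite thetaI_starE.
by apply: expO_mxcol => i; apply: expOD; [exact: (x_order rc uOr i)|exact: (uOr i)].
Qed.

End distributed_learning.

Theorem theorem3 (R : realType) (N n : nat)
  (theta : 'cV[R]_n) (phi : 'I_N -> R -> 'cV[R]_n) (z eps : 'I_N -> R -> R)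
  (T : R) (q : 'I_N -> nat) (Phi : 'I_N -> 'M[R]_n)
  (Nd : forall i : 'I_N, 'M[R]_(n, n - q i))
  (Nu : forall i : 'I_N, 'M[R]_(n, q i))
  (E : rel 'I_N) (a : 'M[R]_N)
  (alpha beta delta kappa eta_d : 'I_N -> R) (theta0 : 'I_N -> 'cV[R]_n)
  (thstar : 'I_N -> R -> 'cV[R]_n) :
  (* measurements *)
  (forall i t, 0 <= t -> z i t = dotv (phi i t) theta + eps i t) ->
  (forall i, smooth (phi i)) ->
  (forall i, exists M : R, forall t, 0 <= t -> enorm (phi i t) <= M) ->
  (forall i, {within `[0, +oo[, continuous (z i)}) ->
  (forall i, exists M : R, forall t, 0 <= t -> `|eps i t| <= M) ->
  (* excitation *)
  0 < T ->
  (forall i, ppe T (phi i) (q i) (Phi i)) ->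
  (forall i, orthonormal_basis_im (Phi i) (Nd i)) ->
  (forall i, orthonormal_basis_ker (Phi i) (Nu i)) ->
  posdef (\sum_(i < N) Phi i) ->
  (* graph *)
  weighted_adjacency E a ->
  strongly_connected E ->
  (* gains other than gamma_i and eta_iu *)
  (forall i, [/\ 0 < alpha i, 0 < beta i, 0 < delta i, 0 < kappa i
               & 0 < eta_d i]) ->
  (* local least squares solutions *)
  (forall i, ls_solution (alpha i) (beta i) (theta0 i) (phi i) (z i)
               (thstar i)) ->
  let noise_free := forall i t, 0 <= t -> eps i t = 0 in
  (* s, thetaU are trajectories of the algorithm and of the reference system
     run with gains gamma, eta_u *)
  let run (gamma eta_u : 'I_N -> R) (s : 'I_N -> node_state R n)
          (thetaU : R -> 'cV[R]_(\sum_(i < N) q i)) :=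
    [/\ forall i, 0 < gamma i /\ 0 < eta_u i,
        learning_algorithm alpha beta gamma delta kappa eta_d eta_u a
          theta0 phi z s
      & reference_system Nd Nu theta thstar a eta_u thetaU] in
  let thetaI (s : 'I_N -> node_state R n) (t : R) :=
    stacked_error theta (fun i => estimate (s i) t) in
  let tracks s thetaU (rho_a rho_b : R) :=
    forall t, 0 <= t ->
      enorm (thetaI s t - thetaI_star Nd Nu theta thstar thetaU t)
        <= rho_a * expR (- (rho_b * t)) in
  let converges s (rho_c rho_d : R) :=
    forall t, 0 <= t -> enorm (thetaI s t) <= rho_c * expR (- (rho_d * t)) in
  [/\ (* arbitrary gains *)
      (forall gamma eta_u s thetaU, run gamma eta_u s thetaU ->
         exists rho_a rho_b : R,
           [/\ 0 < rho_a, 0 < rho_b, tracks s thetaU rho_a rho_b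
             & noise_free -> forall rho_d : R,
                 (forall i, rho_d < beta i / 2) -> rho_d <= rho_b ->
                 exists2 rho_c : R, 0 < rho_c & converges s rho_c rho_d]),
      (* rho_b is arbitrarily large for large gamma_i, eta_iu *)
      (forall r : R, exists gamma0 eta0 : R,
         forall gamma eta_u s thetaU, run gamma eta_u s thetaU ->
         (forall i, gamma0 <= gamma i /\ eta0 <= eta_u i) ->
         exists rho_a rho_b : R,
           [/\ 0 < rho_a, 0 < rho_b, r <= rho_b & tracks s thetaU rho_a rho_b])
    & (* noise-free case *)
      (noise_free -> exists gamma0 eta0 : R,
         forall gamma eta_u s thetaU, run gamma eta_u s thetaU ->
         (forall i, gamma0 <= gamma i /\ eta0 <= eta_u i) ->
         forall rho_d : R, (forall i, rho_d < beta i / 2) ->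
         exists2 rho_c : R, 0 < rho_c & converges s rho_c rho_d)].
Proof.
move=> zE phi_smooth phi_bnd zc eps_bnd T0 phi_ppe Nd_basis Nu_basis Ppos wa sc gains ls.
move=> noise_free run thetaI tracks converges.
pose nn := @nonneg_times R.
have phic i k : {within `[0, +oo[, continuous (fun t => phi i t k 0)}.
  have [F [F0 /(_ 0%N)/ode_mx/(_ k 0)[Fc _]]] := phi_smooth i.
  apply: (subspace_eq_continuous _ Fc) => t; rewrite inE/= in_itv/= andbT => t0.
  by rewrite /from_subspace F0.
have phiO i : expO nn 0 (phi i).
  have [M MP] := phi_bnd i; apply: expO_enorm; apply: (@sexpO_bounded _ _ M) => t t0.
  by rewrite ger0_norm ?sqrtr_ge0// MP.
have zO i : sexpO nn 0 (z i).
  have [M MP] := eps_bnd i.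
  apply: (sexpO_ext (fun t t0 => esym (zE i t t0))); apply: sexpOD.
    by have := sexpO_dotv (phiO i) (expO_cst nn theta); rewrite addr0.
  exact: (sexpO_bounded MP).
have Pproj i : orthogonal_projection (Phi i) by have [] := phi_ppe i.
(* [c] is obtained before any gains are introduced, so the thresholds below can be stated in terms
   of it. *)
have [c c0 contr] := consensus_contraction wa Pproj sc Ppos.
have track gamma eta_u s thetaU rho : run gamma eta_u s thetaU ->
    (forall i, rho < gamma i) -> (forall i, rho < c * eta_u i) ->
    exists2 rho_a, 0 < rho_a & tracks s thetaU rho_a rho.
  move=> [gp alg ref] rg rc.
  have := estimates_track phic phiO zc zO T0 phi_ppe Nd_basis Nu_basis wa sc gains ls
    gp alg ref c0 contr rg rc.
  move=> /sexpO_enorm/sexpO_pos[C C0 H]; exists C => // t t0.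
  by rewrite -[leLHS]ger0_norm ?sqrtr_ge0//; exact: H.
have conv gamma eta_u s thetaU rho : noise_free -> run gamma eta_u s thetaU ->
    (forall i, rho < gamma i) -> (forall i, rho < c * eta_u i) ->
    (forall i, rho < beta i / 2) -> exists2 rho_c, 0 < rho_c & converges s rho_c rho.
  move=> nf [gp alg ref] rg rc rb.
  have zE' i t : 0 <= t -> z i t = dotv (phi i t) theta.
    by move=> t0; rewrite zE// nf// addr0.
  have rb' i : rho <= beta i by have [_ b0 _ _ _] := gains i; have := rb i; lra.
  have := expOD
    (estimates_track phic phiO zc zO T0 phi_ppe Nd_basis Nu_basis wa sc gains ls
      gp alg ref c0 contr rg rc)
    (noise_free_reference phic phiO zc zO T0 phi_ppe Nd_basis Nu_basis wa gains ls
      gp alg ref contr zE' rb' rc).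
  move=> /sexpO_enorm/sexpO_pos[C C0 H]; exists C => // t t0.
  rewrite -[leLHS]ger0_norm ?sqrtr_ge0//.
  by have := H t t0; rewrite subrK.
have bounded_above (f : 'I_N -> R) : exists M, forall i, f i < M.
  exists (\sum_i `|f i| + 1) => i; rewrite (le_lt_trans (ler_norm _))//.
  by rewrite (bigD1 i)//= ltr_pwDr// lerDl sumr_ge0.
split.
- move=> gamma eta_u s thetaU rn; have [gp _ _] := rn.
  (* Half of a common lower bound of the node rates [gamma i] and the consensus rates [c * eta_u i]
     serves as [rho_b], strictly below all of them. *)
  have [m m0 mP] := @ord_pos_lower_bound R N (fun i => Num.min (gamma i) (c * eta_u i))
    (fun i => ltac:(by rewrite lt_min; have [-> ?] := gp i; rewrite mulr_gt0)).
  have mg i : m / 2 < gamma i.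
    by have := mP i; rewrite le_min => /andP[h _]; lra.
  have mc i : m / 2 < c * eta_u i.
    by have := mP i; rewrite le_min => /andP[_ h]; lra.
  have [rho_a a0 tr] := track _ _ _ _ _ rn mg mc.
  exists rho_a, (m / 2); split=> //; first by rewrite divr_gt0.
  move=> nf rho_d rb rm; apply: (conv _ _ _ _ _ nf rn) => // i.
    exact: le_lt_trans rm (mg i).
  exact: le_lt_trans rm (mc i).
(* The maximum with 1 keeps the rate positive when [r] is not, and the added 1 makes the required
   inequalities strict. *)
- move=> r; exists (Num.max r 1 + 1), ((Num.max r 1 + 1) / c).
  move=> gamma eta_u s thetaU rn big; pose rho := Num.max r 1.
  have [|i|rho_a a0 tr] := track _ _ _ _ rho rn.
  + by move=> i; have [h _] := big i; rewrite (lt_le_trans _ h)// ltrDl.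
  + have [_ h] := big i; move: h; rewrite ler_pdivrMr// mulrC => h.
    by rewrite (lt_le_trans _ h)// ltrDl.
  exists rho_a, rho; split=> //; last by rewrite le_max lexx.
  by rewrite (lt_le_trans ltr01)// le_max lexx orbT.
(* With gains beyond [M] and [M / c], neither the filters nor the consensus is slower than any rate
   below all [beta i / 2]. *)
- move=> nf; have [M MP] := bounded_above (fun i => beta i / 2).
  exists M, (M / c) => gamma eta_u s thetaU rn big rho_d rb.
  apply: (conv _ _ _ _ _ nf rn) => // i; apply: (lt_trans (rb i)).
    by have [h _] := big i; exact: lt_le_trans (MP i) h.
  have [_ h] := big i; move: h; rewrite ler_pdivrMr// mulrC => h.
  exact: lt_le_trans (MP i) h.
Qed.
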